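(* Let $$A(x,y)=A_0+\sum_{i=1}^n x_iA_i+\sum_{j=1}^r y_jA_{n+j},\qquad B(x,z)=B_0+\sum_{i=1}^n x_iB_i+\sum_{j=1}^s z_jB_{n+j}$$ be linear pencils, where all $A_i$ are real symmetric $k\times k$ matrices and all $B_i$ are real symmetric $t\times t$ matrices. Let $P_A=\{x\in\mathbb{R}^n:\exists y\in\mathbb{R}^r,\ A(x,y)\succeq 0\}$. Assume that $\mathrm{QM}_t(A)\cap\mathcal{S}\mathbb{R}[x]^{t\times t}$ is archimedean. If there is $\epsilon>0$ such that for each $x\in P_A$ there exists $z\in\mathbb{R}^s$ with $B(x,z)\succeq\epsilon I$, then there exists a tuple $f(x)=(f_1(x),\dots,f_s(x))$ of polynomials in $\mathbb{R}[x]$ such that $$B(x,f(x))=B_0+\sum_{i=1}^n x_iB_i+\sum_{j=1}^s f_j(x)B_{n+j}\ \in\ \mathrm{QM}_t(A).$$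
   Context: Here $x=(x_1,\dots,x_n)$, $y=(y_1,\dots,y_r)$, $z=(z_1,\dots,z_s)$. $\mathcal{S}\mathbb{R}[x]^{t\times t}$ denotes the space of $t\times t$ real symmetric matrix polynomials in $x$. $C\succeq 0$ means that the real symmetric matrix $C$ is positive semidefinite, and $C\succeq D$ means $C-D\succeq 0$; $I$ is the identity matrix. The quadratic module generated by the $k\times k$ pencil $A=A(x,y)$ in $\mathcal{S}\mathbb{R}[x,y]^{t\times t}$ is $$\mathrm{QM}_t(A)=\Big\{\sum_{i=1}^L p_i^Tg_ip_i:\ L\in\mathbb{N},\ g_i\in\{I_k,A\},\ p_i\in\mathbb{R}[x,y]^{k\times t}\Big\}.$$ The intersection $\mathrm{QM}_t(A)\cap\mathcal{S}\mathbb{R}[x]^{t\times t}$ (the elements of $\mathrm{QM}_t(A)$ not depending on $y$) is called archimedean if there exists $g(x)\in\mathrm{QM}_t(A)\cap\mathcal{S}\mathbb{R}[x]^{t\times t}$ such that the set $\{x\in\mathbb{R}^n: g(x)\succeq 0\}$ is compact. *)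

(* Defs.v *)
From HB Require Import structures.
From mathcomp Require Export all_boot all_order all_algebra.
From mathcomp Require Export all_classical all_reals all_analysis.
(* The notations of mpoly clash with those of all_analysis. *)
From mathcomp Require Export -(notations) mpoly.
Export numFieldNormedType.Exports.

Set Implicit Arguments.
Unset Strict Implicit.
Unset Printing Implicit Defensive.

Import Order.TTheory GRing.Theory Num.Theory.

Local Open Scope ring_scope.
Local Open Scope classical_set_scope.

Definition psd (R : realType) (m : nat) (C : 'M[R]_m) : Prop :=
  C \is symmetricmx /\ forall v : 'cV[R]_m, 0 <= (v^T *m C *m v) ord0 ord0.

Definition loewner_ge (R : realType) (m : nat) (C D : 'M[R]_m) : Prop :=
  psd (C - D).

(* C_0 + \sum_i x_i C_i + \sum_j w_j C_(n+j), with (C_1, ..., C_n) given by Cx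
   and (C_(n+1), ..., C_(n+q)) by Cw.  The ring K is either the reals (value of
   a pencil at a point) or a polynomial ring over them. *)
Definition pencil (K : nzRingType) (m n q : nat) (C0 : 'M[K]_m)
    (Cx : 'I_n -> 'M[K]_m) (Cw : 'I_q -> 'M[K]_m)
    (x : 'rV[K]_n) (w : 'rV[K]_q) : 'M[K]_m :=
  C0 + \sum_(i < n) x ord0 i *: Cx i + \sum_(j < q) w ord0 j *: Cw j.

(* Real coefficients, arguments in R[u_0, ..., u_(N-1)]. *)
Definition poly_pencil (R : realType) (N m n q : nat) (C0 : 'M[R]_m)
    (Cx : 'I_n -> 'M[R]_m) (Cw : 'I_q -> 'M[R]_m)
    (x : 'rV[mpoly N R]_n) (w : 'rV[mpoly N R]_q) : 'M[mpoly N R]_m :=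
  pencil (map_mx (@mpolyC N R) C0) (fun i => map_mx (@mpolyC N R) (Cx i))
    (fun j => map_mx (@mpolyC N R) (Cw j)) x w.

Definition mvar (R : realType) (N : nat) (i : 'I_N) : mpoly N R :=
  mpolyX R (mnm1 i).

(* R[x, y] is represented by mpoly (n + r) R: the variables x come first. *)
Definition xvars (R : realType) (n r : nat) : 'rV[mpoly (n + r) R]_n :=
  \row_(i < n) mvar R (lshift r i).

Definition yvars (R : realType) (n r : nat) : 'rV[mpoly (n + r) R]_r :=
  \row_(j < r) mvar R (rshift n j).

(* The inclusion of R[x] in R[x, y], entrywise on matrices. *)
Definition x_to_xy (R : realType) (n r m : nat) (g : 'M[mpoly n R]_m) :
    'M[mpoly (n + r) R]_m :=
  map_mx (comp_mpoly [tuple mvar R (lshift r i) | i < n]) g.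

(* For symmetric A, all members M are automatically symmetric. *)
Definition in_QM (K : comNzRingType) (k t : nat) (A : 'M[K]_k) (M : 'M[K]_t) :
    Prop :=
  exists (L : nat) (g : 'I_L -> 'M[K]_k) (p : 'I_L -> 'M[K]_(k, t)),
    (forall i, g i = 1%:M \/ g i = A) /\
    M = \sum_(i < L) (p i)^T *m g i *m p i.

(* Symmetry is spelled out: symmetricmx is only available over a field. *)
Definition in_QM_x (R : realType) (n r k t : nat)
    (A : 'M[mpoly (n + r) R]_k) (g : 'M[mpoly n R]_t) : Prop :=
  g^T = g /\ in_QM A (x_to_xy r g).

Definition archimedean_QM_x (R : realType) (n r k t : nat)
    (A : 'M[mpoly (n + r) R]_k) : Prop :=
  exists g : 'M[mpoly n R]_t, in_QM_x A g /\
    compact [set x : 'rV[R]_n | psd (map_mx (meval (x ord0)) g)].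

(* Main.v *)
Require Import Defs.
From mathcomp Require Import ring lra sesquilinear.

(** Why the theorem is true.  Let [M] be the quadratic module of [A] in the
    scalar polynomials and call [p] approximately positive when
    [p + e] lies in [M] for every real [e > 0].

    The naive choice of [f] is a continuous selection of the [z] offered by the
    hypothesis, made polynomial by a partition of unity: with finitely many
    points [c_j], weights [b_j] summing to [1] and values [z_j], put
    [f = \sum_j b_j z_j].  Since [B] is affine in [z],
    [B(x, f) = \sum_j b_j B(x, z_j)], and only certificates of positivity are
    left to find.  They come from four facts.

    (1) On a quadratic module in which every polynomial is bounded, the
    approximately positive polynomials are closed under products ([aclosM]).
    The proof is F. Riesz's argument for commuting positive operators: if
    [0 <= a <= 1] then [a] is a sum of squares of polynomials in [a] up to an
    arbitrarily small remainder.

    (2) Products of the weights [t] and [1 - t] of independent coin tosses, one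
    family for each variable, form a partition of unity with
    [\sum_j b_j |x - c_j|^2] arbitrarily small: this is the variance of a mean
    of independent variables ([partition_of_unity]).

    (3) An affine function that is nonnegative on the projection [P_A] is
    approximately positive ([pencil_duality]).  Nonnegativity only puts it in
    the closure of the cone spanned by [1] and the [v^T A v].  That cone may
    fail to be closed, but it becomes closed modulo the affine functions [h] for
    which [h] and [- h] are both positive in a suitable sense: if [v^T A v] is
    null in this sense, then so is the whole vector [A v] ([null_bil]), so that
    in the quotient one may discard such [v], and no other psd combination
    vanishes.  Everything null is approximately positive, whence the claim
    ([sclos_duality]).  Applied to the bounds of the coordinates on [P_A],
    which is bounded by the archimedean hypothesis, this shows that all of
    [R[x]] is bounded with respect to [M] ([scalar_QM_x_arch]).

    (4) If [c] is far from [P_A] then [|x - c|^2] is bounded below on [P_A] with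
    a certificate, because a hyperplane separates [c] from the convex set [P_A]
    and (3) applies to it ([dist2_far]).

    To conclude, every term [B(x, z_j) - eps / 2 + kappa |x - c_j|^2] is
    positive for one constant [kappa]: if [c_j] is near a point [x'] of [P_A]
    and [z_j] is taken from [x'], the error [B(x, z_j) - B(x', z_j)] is absorbed
    by [|x - c_j|^2]; if [c_j] is far, [z_j = 0] will do, since [B(x, 0)] is
    bounded and (4) makes [kappa |x - c_j|^2] large ([pencil_pointwise]).
    Averaging with the weights [b_j], (1) keeps positivity and (2) makes the
    added term negligible ([certified_selection]). *)

Set Implicit Arguments.
Unset Strict Implicit.
Unset Printing Implicit Defensive.

Import Order.TTheory GRing.Theory Num.Theory.
Local Open Scope ring_scope.
Local Open Scope classical_set_scope.

(** * Quadratic modules of a commutative ring *)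

Section QuadraticModules.
Variables (R : realType) (K : comNzRingType) (C : {rmorphism R -> K}).

Definition qmodule (M : K -> Prop) : Prop :=
  [/\ M 1, forall p q, M p -> M q -> M (p + q) &
      forall q p, M p -> M (q ^+ 2 * p)].

(** The closure of [M] along the direction [1]; for polynomials that are bounded
    with respect to [M] this is the only closure that matters, and the final
    step recovers membership from a positive margin. *)
Definition aclos (M : K -> Prop) (p : K) : Prop :=
  forall e : R, 0 < e -> M (p + C e).

Definition arch (M : K -> Prop) : Prop :=
  forall p, exists N : R, M (C N - p).

Variable M : K -> Prop.
Hypothesis qM : qmodule M.

Lemma qmD p q : M p -> M q -> M (p + q). Proof. by case: qM => _ h _; exact: h. Qed.

Lemma qmS q p : M p -> M (q ^+ 2 * p). Proof. by case: qM => _ _; exact. Qed.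

Lemma qm_sqr q : M (q ^+ 2).
Proof. by rewrite -[_ ^+ 2]mulr1; apply: qmS; case: qM. Qed.

Lemma qm0 : M 0. Proof. by have := qm_sqr 0; rewrite expr0n. Qed.

Lemma qmZ (c : R) p : 0 <= c -> M p -> M (C c * p).
Proof.
by move=> c0 Mp; rewrite -[c]sqr_sqrtr// rmorphXn; exact: qmS.
Qed.

Lemma qmC (c : R) : 0 <= c -> M (C c).
Proof. by move=> c0; rewrite -[C c]mulr1; apply: qmZ => //; case: qM. Qed.

Lemma qm_sum (J : finType) (F : J -> K) :
  (forall j, M (F j)) -> M (\sum_j F j).
Proof. by move=> h; apply: big_ind => //; [exact: qm0|exact: qmD]. Qed.

Lemma half_add_half : C 2^-1 + C 2^-1 = 1.
Proof. by rewrite -rmorphD (_ : 2^-1 + 2^-1 = 1 :> R) ?rmorph1//; lra. Qed.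

Lemma qm_all : M (- 1) -> forall p, M p.
Proof.
move=> h p.
have -> : p = (C 2^-1 * (p + 1)) ^+ 2 + (C 2^-1 * (p - 1)) ^+ 2 * - 1.
  transitivity ((C 2^-1 + C 2^-1) ^+ 2 * p); last by ring.
  by rewrite half_add_half; ring.
by apply: qmD; [exact: qm_sqr|exact: qmS].
Qed.

Lemma aclos_incl p : M p -> aclos M p.
Proof. by move=> Mp e e0; apply: qmD => //; apply: qmC; apply: ltW. Qed.

Lemma aclosD p q : aclos M p -> aclos M q -> aclos M (p + q).
Proof.
move=> hp hq e e0.
have -> : p + q + C e = (p + C (e / 2)) + (q + C (e / 2)).
  by rewrite [in LHS](_ : e = e / 2 + e / 2); [ring|lra].
by apply: qmD; [apply: hp|apply: hq]; lra.
Qed.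

Lemma aclos_idem p : aclos (aclos M) p -> aclos M p.
Proof.
move=> h e e0.
have -> : p + C e = (p + C (e / 2)) + C (e / 2).
  by rewrite [in LHS](_ : e = e / 2 + e / 2); [ring|lra].
by apply: h; lra.
Qed.

Lemma aclosZ (c : R) p : 0 <= c -> aclos M p -> aclos M (C c * p).
Proof.
rewrite le_eqVlt => /predU1P[<- _|c0 hp e e0].
  by rewrite rmorph0 mul0r; apply: aclos_incl; exact: qm0.
have -> : C c * p + C e = C c * (p + C (e / c)).
  by rewrite mulrDr -rmorphM mulrC [c * _]mulrC mulfVK ?gt_eqF// mulrC.
by apply: qmZ; [exact: ltW|apply: hp; exact: divr_gt0].
Qed.

(** [2 N (N^2 - p^2) = (N + p)^2 (N - p) + (N - p)^2 (N + p)]. *)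
Lemma qm_bound_sqr (N : R) p : 0 < N -> M (C N - p) -> M (C N + p) ->
  M (C (N ^+ 2) - p ^+ 2).
Proof.
move=> N0 h1 h2.
have e : C (2 * N) * (C (N ^+ 2) - p ^+ 2)
    = (C N + p) ^+ 2 * (C N - p) + (C N - p) ^+ 2 * (C N + p) by ring.
have -> : C (N ^+ 2) - p ^+ 2
    = C (2 * N)^-1 * (C (2 * N) * (C (N ^+ 2) - p ^+ 2)).
  by rewrite mulrA -rmorphM /= mulVf ?rmorph1 ?mul1r//; lra.
apply: qmZ; first by rewrite invr_ge0; lra.
by rewrite e; apply: qmD; exact: qmS.
Qed.

(** The bounded elements form a subalgebra, by the lemmas below; hence [M] is
    archimedean as soon as it bounds a set of generators. *)
Definition mbounded (p : K) : Prop :=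
  exists2 N : R, 0 < N & M (C N - p) /\ M (C N + p).

Lemma mbounded1 : mbounded 1.
Proof.
exists 1; rewrite ?rmorph1 ?subrr//; split; first exact: qm0.
by apply: qmD; case: qM.
Qed.

Lemma mboundedD p q : mbounded p -> mbounded q -> mbounded (p + q).
Proof.
move=> [a a0 [h1 h2]] [b b0 [h3 h4]]; exists (a + b); first by lra.
split.
  by rewrite (_ : _ - _ = (C a - p) + (C b - q)); [exact: qmD|ring].
by rewrite (_ : _ + _ = (C a + p) + (C b + q)); [exact: qmD|ring].
Qed.

Lemma mboundedN p : mbounded p -> mbounded (- p).
Proof. by move=> [a a0 [h1 h2]]; exists a; rewrite // opprK. Qed.

Lemma mboundedZ (c : R) p : mbounded p -> mbounded (C c * p).
Proof.
have pos (d : R) q : 0 <= d -> mbounded q -> mbounded (C d * q).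
  move=> d0 [a a0 [h1 h2]]; have da : 0 <= d * a by rewrite mulr_ge0// ltW.
  have one : M (C 1) by rewrite rmorph1; case: qM.
  exists (d * a + 1); first by lra.
  split.
    rewrite (_ : _ - _ = C d * (C a - q) + C 1); last by ring.
    by apply: qmD => //; exact: qmZ.
  rewrite (_ : _ + _ = C d * (C a + q) + C 1); last by ring.
  by apply: qmD => //; exact: qmZ.
move=> hp; have [c0|/ltW c0] := leP 0 c; first exact: pos.
rewrite -[C c * p]opprK -mulNr -rmorphN; apply/mboundedN/pos => //.
by rewrite oppr_ge0.
Qed.

Lemma mbounded_sqr p : mbounded p -> mbounded (p ^+ 2).
Proof.
move=> [a a0 [h1 h2]]; exists (a ^+ 2); first by rewrite exprn_gt0.
split; first exact: qm_bound_sqr.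
by apply: qmD; [apply: qmC; exact: sqr_ge0|exact: qm_sqr].
Qed.

Lemma mboundedM p q : mbounded p -> mbounded q -> mbounded (p * q).
Proof.
move=> hp hq.
have -> : p * q = C 4^-1 * ((p + q) ^+ 2 + - (p - q) ^+ 2).
  transitivity (C 4^-1 * C 4 * (p * q)); last by rewrite rmorph_nat; ring.
  by rewrite -rmorphM mulVf ?pnatr_eq0// rmorph1 mul1r.
apply/mboundedZ/mboundedD; [|apply: mboundedN]; apply/mbounded_sqr/mboundedD => //.
exact: mboundedN.
Qed.

Section Archimedean.
Hypothesis aM : arch M.

Lemma arch_bound p : mbounded p.
Proof.
have [N1 h1] := aM p; have [N2 h2] := aM (- p); rewrite opprK in h2.
have n1 := ler_norm N1; have n2 := ler_norm N2.
have a1 := normr_ge0 N1; have a2 := normr_ge0 N2.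
exists (`|N1| + `|N2| + 1); first by lra.
split.
- have -> : C (`|N1| + `|N2| + 1) - p = C (`|N1| + `|N2| + 1 - N1) + (C N1 - p) by ring.
  by apply: qmD => //; apply: qmC; lra.
- have -> : C (`|N1| + `|N2| + 1) + p = C (`|N1| + `|N2| + 1 - N2) + (C N2 + p) by ring.
  by apply: qmD => //; apply: qmC; lra.
Qed.

(** Multiplying the error term [e] by [q^2] is harmless only because [q^2] is
    bounded: this is where the archimedean property enters. *)
Lemma aclosS q p : aclos M p -> aclos M (q ^+ 2 * p).
Proof.
move=> hp e e0; have [N N0 [h1 h2]] := arch_bound q.
have := qm_bound_sqr N0 h1 h2 => h.
have N20 : 0 < N ^+ 2 by rewrite exprn_gt0.
set d := e / N ^+ 2; have d0 : 0 < d by rewrite divr_gt0.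
have -> : q ^+ 2 * p + C e = q ^+ 2 * (p + C d) + C d * (C (N ^+ 2) - q ^+ 2).
  have -> : C e = C d * C (N ^+ 2) by rewrite -rmorphM /= mulfVK ?gt_eqF.
  by ring.
by apply: qmD; [apply: qmS; exact: hp|apply: qmZ => //; exact: ltW].
Qed.

Lemma aclos_qmodule : qmodule (aclos M).
Proof.
split; [|exact: aclosD|by move=> *; exact: aclosS].
by apply: aclos_incl; case: qM.
Qed.

End Archimedean.
End QuadraticModules.

Section Product.
Variables (R : realType) (K : comNzRingType) (C : {rmorphism R -> K}).
Variable M : K -> Prop.
Hypothesis qM : qmodule M.

(** F. Riesz's iteration: for [0 <= a <= 1] it decreases to [0] while
    subtracting a square at each step. *)
Fixpoint riesz (a : K) (n : nat) : K :=
  if n is m.+1 then riesz a m - riesz a m ^+ 2 else a.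

Lemma riesz_sum a n : a = \sum_(i < n) riesz a i ^+ 2 + riesz a n.
Proof.
elim: n => [|n IH] /=; first by rewrite big_ord0 add0r.
by rewrite big_ord_recr /= {1}IH; ring.
Qed.

Lemma riesz_bounds a n : M a -> M (1 - a) -> M (riesz a n) /\ M (1 - riesz a n).
Proof.
move=> a0 a1; elim: n => [|n [h0 h1]] //=; set b := riesz a n in h0 h1 *.
split.
- rewrite (_ : b - b ^+ 2 = (1 - b) ^+ 2 * b + b ^+ 2 * (1 - b)); last by ring.
  by apply: (qmD qM); exact: (qmS qM).
- rewrite (_ : 1 - (b - b ^+ 2) = (1 - b) + b ^+ 2); last by ring.
  by apply: (qmD qM) => //; exact: (qm_sqr qM).
Qed.

Lemma riesz_decr a i n : M a -> M (1 - a) -> (i <= n)%N ->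
  M (riesz a i ^+ 2 - riesz a n ^+ 2).
Proof.
move=> a0 a1; elim: n => [|n IH].
  by rewrite leqn0 => /eqP ->; rewrite subrr; exact: (qm0 qM).
rewrite leq_eqVlt => /predU1P[->|]; first by rewrite subrr; exact: (qm0 qM).
rewrite ltnS => /IH h.
have -> : riesz a i ^+ 2 - riesz a n.+1 ^+ 2 =
  (riesz a i ^+ 2 - riesz a n ^+ 2) + riesz a n ^+ 2 * (riesz a n + riesz a n.+1).
  by rewrite /=; ring.
apply: (qmD qM) => //; apply: (qmS qM); apply: (qmD qM).
  exact: (riesz_bounds n a0 a1).1.
exact: (riesz_bounds n.+1 a0 a1).1.
Qed.

(** The first [n] iterates dominate the last one and their squares add up to
    at most [a <= 1]. *)
Lemma riesz_small a n : M a -> M (1 - a) -> M (1 - riesz a n ^+ 2 *+ n).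
Proof.
move=> a0 a1.
have -> : 1 - riesz a n ^+ 2 *+ n =
   (1 - a) + riesz a n + \sum_(i < n) (riesz a i ^+ 2 - riesz a n ^+ 2).
  rewrite sumrB sumr_const card_ord.
  rewrite {2}(riesz_sum a n); ring.
apply: (qmD qM); first by apply: (qmD qM) => //; exact: (riesz_bounds n a0 a1).1.
by apply: (qm_sum qM) => i; apply: riesz_decr => //; exact: ltnW.
Qed.

End Product.

Section ProductClosure.
Variables (R : realType) (K : comNzRingType) (C : {rmorphism R -> K}).
Variable M : K -> Prop.
Hypotheses (qM : qmodule M) (aM : arch C M).

Let qA := aclos_qmodule qM aM.

(** Multiply Riesz's decomposition of [a] by [b]: the squares times [b] are in
    the closure, and the product of the small remainder with [b] is small. *)
Lemma aclosM_unit a b : aclos C M a -> aclos C M (1 - a) -> aclos C M b ->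
  aclos C M (1 - b) -> aclos C M (a * b).
Proof.
move=> a0 a1 b0 b1; apply: (aclos_idem (C := C)) => e e0.
have [n n0 ne] : exists2 n : nat, (0 < n)%N & (e ^- 2) <= n%:R :> R.
  exists (Num.bound (e ^- 2)).
    rewrite lt0n; apply/eqP => z.
    have := @archi_boundP _ (e ^- 2); rewrite z => h.
    have : 0 <= e ^- 2 by rewrite invr_ge0 sqr_ge0.
    by move=> /[dup] /h; lra.
  by apply/ltW/archi_boundP; rewrite invr_ge0 sqr_ge0.
set r := riesz a n.
have hr := riesz_small qA n a0 a1; rewrite -/r in hr.
have n0R : 0 < n%:R :> R by rewrite ltr0n.
have e20 : 0 < e ^+ 2 by rewrite exprn_gt0.
have hr2 : aclos C M (C (e ^+ 2) - r ^+ 2).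
  have -> : C (e ^+ 2) - r ^+ 2 = C (e ^+ 2 - n%:R^-1) + C n%:R^-1 * (1 - r ^+ 2 *+ n).
    rewrite rmorphB mulrBr mulr1 -[r ^+ 2 *+ n]mulr_natl mulrA.
    rewrite -(rmorph_nat C) -rmorphM mulVf ?gt_eqF//= rmorph1; ring.
  apply: (qmD qA); last by apply: (qmZ C qA) => //; rewrite invr_ge0 ltW.
  by apply: (qmC C qA); rewrite subr_ge0 invf_ple ?posrE.
have rb : aclos C M (r * b + C e).
  have hb2 : aclos C M (1 - b ^+ 2).
    have := @qm_bound_sqr _ _ C _ qA 1 b ltr01.
    rewrite expr1n rmorph1; apply => //.
    by apply: (qmD qA) => //; case: qA.
  have -> : r * b + C e = C (2 * e)^-1 *
      ((r + C e * b) ^+ 2 + (C (e ^+ 2) - r ^+ 2) + C e ^+ 2 * (1 - b ^+ 2)).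
    transitivity (C (2 * e)^-1 * (C (2 * e) * (r * b + C e))); last by congr (_ * _); ring.
    by rewrite mulrA -rmorphM mulVf ?rmorph1 ?mul1r//; lra.
  apply: (qmZ C qA); first by rewrite invr_ge0; lra.
  apply: (qmD qA); last exact: (qmS qA).
  by apply: (qmD qA) => //; exact: (qm_sqr qA).
rewrite {1}(riesz_sum a n) -/r mulrDl -addrA mulr_suml.
apply: (qmD qA) => //; apply: (qm_sum qA) => i; exact: (qmS qA).
Qed.

Lemma aclosM a b : aclos C M a -> aclos C M b -> aclos C M (a * b).
Proof.
move=> a0 b0.
have [N N0 [hN _]] := arch_bound qM aM a.
have [L L0 [hL _]] := arch_bound qM aM b.
have scale (c : K) (N' : R) : 0 < N' -> aclos C M c -> M (C N' - c) ->
    aclos C M (C N'^-1 * c) /\ aclos C M (1 - C N'^-1 * c).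
  move=> N'0 hc hN'.
  have i0 : 0 <= N'^-1 by rewrite invr_ge0 ltW.
  split; first exact: (qmZ C qA).
  have -> : 1 - C N'^-1 * c = C N'^-1 * (C N' - c).
    by rewrite mulrBr -rmorphM mulVf ?gt_eqF// rmorph1.
  by apply: (qmZ C qA) => //; apply: (aclos_incl C qM).
have [a1 a2] := scale a N N0 a0 hN; have [b1 b2] := scale b L L0 b0 hL.
have := aclosM_unit a1 a2 b1 b2.
move/(qmZ C qA (ltW (mulr_gt0 N0 L0))).
have -> // : C (N * L) * (C N^-1 * a * (C L^-1 * b)) = a * b.
rewrite rmorphM /= (_ : _ * _ = (C N * C N^-1) * (C L * C L^-1) * (a * b)); last by ring.
by rewrite -!rmorphM !mulfV ?gt_eqF// mul1r rmorph1 mul1r.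
Qed.
End ProductClosure.

(** * Polynomial partitions of unity *)

Section PartitionOfUnity.
Variables (R : realType) (K : comNzRingType) (C : {rmorphism R -> K}).
Variable M : K -> Prop.
Hypotheses (qM : qmodule M) (aM : arch C M).

Let qA := aclos_qmodule qM aM.

(** The steps of a random walk are independent coins with parameter [t]: the
    weights are the probabilities of the [2^d] outcomes, [c] counts the
    successes, and the last identity is the variance of a binomial variable.
    The induction adds one coin. *)
Lemma bernoulli_walk (t : K) (d : nat) : aclos C M t -> aclos C M (1 - t) ->
  exists (J : finType) (b : J -> K) (c : J -> R),
    [/\ forall j, aclos C M (b j), \sum_j b j = 1 &
        \sum_j b j * (C (c j) - t *+ d) ^+ 2 = (t * (1 - t)) *+ d].
Proof.
move=> t0 t1; elim: d => [|d [J [b [c [b0 b1 bV]]]]].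
  exists unit, (fun=> 1), (fun=> 0); split=> [_||]; first by case: qA.
    by rewrite big_const card_unit /= addr0.
  by rewrite big1// => _ _; rewrite rmorph0 !mulr0n subrr expr0n mulr0.
exists (J * bool)%type, (fun p => b p.1 * (if p.2 then t else 1 - t)),
  (fun p => if p.2 then c p.1 + 1 else c p.1).
have pairE (F : J * bool -> K) : \sum_p F p = \sum_j (F (j, true) + F (j, false)).
  rewrite (eq_bigr (fun p => F (p.1, p.2))); last by case.
  rewrite -(pair_bigA _ (fun j s => F (j, s))) /=; apply: eq_bigr => j _.
  by rewrite big_bool.
split=> [[j []]|| ] /=; try exact: (aclosM qM aM).
- by rewrite pairE /= -[RHS]b1; apply: eq_bigr => j _; ring.
- have e : t * (1 - t) = \sum_j b j * (t * (1 - t)).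
    by rewrite -mulr_suml b1 mul1r.
  rewrite pairE /= [RHS]mulrSr -bV e -big_split /=.
  by apply: eq_bigr => j _; rewrite rmorphD rmorph1 mulrSr; ring.
Qed.

(** The mean of [d] coins with parameter [t = (x + N) / 2 N], carried back to
    the interval from [- N] to [N], has variance at most [N^2 / d]. *)
Lemma partition_of_unity1 (x : K) (e : R) : 0 < e ->
  exists (J : finType) (b : J -> K) (c : J -> R),
    [/\ forall j, aclos C M (b j), \sum_j b j = 1 &
        aclos C M (C e - \sum_j b j * (x - C (c j)) ^+ 2)].
Proof.
move=> e0; have [N N0 [hm hp]] := arch_bound qM aM x.
have N2 : 0 < N ^+ 2 by rewrite exprn_gt0.
pose d := (Num.bound (N ^+ 2 / e)).+1.
have dN : N ^+ 2 / d%:R <= e.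
  rewrite ler_pdivrMr ?ltr0n// mulrC -ler_pdivrMr//; apply: ltW.
  apply: lt_trans (_ : (Num.bound (N ^+ 2 / e))%:R < _); last by rewrite ltr_nat.
  by apply: archi_boundP; rewrite divr_ge0 ?ltW.
have d0 : 0 < d%:R :> R by rewrite ltr0n.
pose t := C (2 * N)^-1 * (x + C N).
have iN : 0 <= (2 * N)^-1 by rewrite invr_ge0; lra.
have NN : C (2 * N) * C (2 * N)^-1 = 1.
  by rewrite -rmorphM mulfV ?rmorph1//; lra.
have t0 : aclos C M t.
  by apply: (aclos_incl C qM); apply: (qmZ C qM) => //; rewrite addrC.
have t1E : 1 - t = C (2 * N)^-1 * (C N - x) by rewrite -NN /t; ring.
have t1 : aclos C M (1 - t).
  by rewrite t1E; apply: (aclos_incl C qM); apply: (qmZ C qM).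
have [J [b [c [b0 b1 bV]]]] := bernoulli_walk d t0 t1.
exists J, b, (fun j => 2 * N * (c j / d%:R) - N); split=> //.
have xE : x = C (2 * N) * t - C N by rewrite /t mulrA NN; ring.
have dd : C d%:R * C d%:R^-1 = 1 by rewrite -rmorphM mulfV ?rmorph1 ?gt_eqF.
have -> : \sum_j b j * (x - C (2 * N * (c j / d%:R) - N)) ^+ 2
    = C (2 * N) ^+ 2 * C d%:R^-1 * (t * (1 - t)).
  transitivity (C (2 * N) ^+ 2 * C d%:R^-1 ^+ 2 * (t * (1 - t) *+ d)).
    rewrite -bV mulr_sumr; apply: eq_bigr => j _.
    rewrite xE -[t *+ d]mulr_natl -(rmorph_nat C).
    transitivity (b j * (C (2 * N) * ((C d%:R * C d%:R^-1) * t - C (c j) * C d%:R^-1)) ^+ 2).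
      by rewrite dd; ring.
    by ring.
  rewrite -[t * _ *+ d]mulr_natl -(rmorph_nat C).
  transitivity (C (2 * N) ^+ 2 * C d%:R^-1 * (C d%:R * C d%:R^-1) * (t * (1 - t))).
    by ring.
  by rewrite dd; ring.
have -> : C e - C (2 * N) ^+ 2 * C d%:R^-1 * (t * (1 - t)) =
   C (e - N ^+ 2 / d%:R) + C d%:R^-1 * (C N - C (2 * N) * t) ^+ 2 by ring.
apply: (qmD qA); first by apply: (qmC C qA); lra.
by apply: (qmZ C qA); [rewrite invr_ge0 ltW|exact: (qm_sqr qA)].
Qed.

(** Independent copies of the one-variable partition, one for each [x i]; the
    other factors sum to one in each variance. *)
Lemma partition_of_unity n (x : 'I_n -> K) (e : R) : 0 < e ->
  exists (J : finType) (b : J -> K) (c : J -> 'I_n -> R),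
    [/\ forall j, aclos C M (b j), \sum_j b j = 1 &
        forall i, aclos C M (C e - \sum_j b j * (x i - C (c j i)) ^+ 2)].
Proof.
move=> e0; elim: n x => [|n IH] x.
  exists unit, (fun=> 1), (fun _ _ => 0); split=> [_||[]//]; first by case: qA.
  by rewrite big_const card_unit /= addr0.
have [J [b [c [b0 b1 bV]]]] := IH (fun i => x (lift ord_max i)).
have [J' [b' [c' [b0' b1' bV']]]] := partition_of_unity1 (x ord_max) e0.
exists (J * J')%type, (fun p => b p.1 * b' p.2),
  (fun p i => oapp (c p.1) (c' p.2) (unlift ord_max i)).
split=> [[j j'] /=||i]; first exact: (aclosM qM aM).
  rewrite -(pair_bigA _ (fun j j' => b j * b' j')) /= -[RHS]b1.
  by apply: eq_bigr => j _; rewrite -mulr_sumr b1' mulr1.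
have [i' ->|->] := unliftP ord_max i.
  rewrite (_ : \sum__ _ = \sum_j b j * (x (lift ord_max i') - C (c j i')) ^+ 2); first exact: bV.
  rewrite -(pair_bigA _ (fun j j' => b j * b' j' *
    (x (lift ord_max i') - C (c j i')) ^+ 2)) /=.
  apply: eq_bigr => j _.
  transitivity (\sum_j' b' j' * (b j * (x (lift ord_max i') - C (c j i')) ^+ 2)).
    by apply: eq_bigr => j' _; ring.
  by rewrite -mulr_suml b1' mul1r.
rewrite (_ : \sum__ _ = \sum_j b' j * (x ord_max - C (c' j)) ^+ 2); first exact: bV'.
rewrite -(pair_bigA _ (fun j j' => b j * b' j' * (x ord_max - C (c' j')) ^+ 2)) /=.
rewrite exchange_big /=; apply: eq_bigr => j _.
under eq_bigr do rewrite -mulrA.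
by rewrite -mulr_suml b1 mul1r.
Qed.

End PartitionOfUnity.

(** * Positive semidefinite matrices *)

Section PsdMatrices.
Variables (R : realType) (m : nat).
Implicit Types (S : 'M[R]_m) (v : 'cV[R]_m).

Lemma symE S : (S \is symmetricmx) = (S^T == S).
Proof. by rewrite is_hermitianmxE expr0 scale1r map_mx_id// eq_sym. Qed.

Lemma psdP S :
  psd S <-> S^T = S /\ forall v, 0 <= (v^T *m S *m v) ord0 ord0.
Proof. by rewrite /psd symE; split=> -[/eqP]. Qed.

Lemma psd0 : psd (0 : 'M[R]_m).
Proof. by apply/psdP; rewrite trmx0; split=> // v; rewrite mulmx0 mul0mx mxE. Qed.

Lemma psdD S T : psd S -> psd T -> psd (S + T).
Proof.
move=> /psdP[s1 s2] /psdP[t1 t2]; apply/psdP; split=> [|v].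
  by rewrite linearD /= s1 t1.
by rewrite mulmxDr mulmxDl mxE addr_ge0.
Qed.

Lemma psdZ (c : R) S : 0 <= c -> psd S -> psd (c *: S).
Proof.
move=> c0 /psdP[s1 s2]; apply/psdP; split=> [|v]; first by rewrite linearZ /= s1.
by rewrite -scalemxAr -scalemxAl mxE mulr_ge0.
Qed.

Lemma psd_outer v : psd (v *m v^T).
Proof.
apply/psdP; split=> [|w]; first by rewrite trmx_mul trmxK.
rewrite mulmxA -mulmxA (_ : w^T *m v = (v^T *m w)^T); last by rewrite trmx_mul trmxK.
by rewrite mxE big_ord1 mxE -expr2 sqr_ge0.
Qed.

Lemma quad_sub S (a : R) (v e : 'cV[R]_m) : S^T = S ->
  ((v - a *: e)^T *m S *m (v - a *: e)) ord0 ord0 =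
  (v^T *m S *m v) ord0 ord0 - 2 * a * (e^T *m S *m v) ord0 ord0
    + a ^+ 2 * (e^T *m S *m e) ord0 ord0.
Proof.
move=> sS.
have c : (v^T *m S *m e) ord0 ord0 = (e^T *m S *m v) ord0 ord0.
  rewrite -[LHS](mxE trmx_key (fun i j => (v^T *m S *m e) j i)) -/(trmx _).
  by rewrite !trmx_mul trmxK sS mulmxA.
rewrite [(v - _)^T]linearB /= [(a *: e)^T]linearZ /= !mulmxBr !mulmxBl -!scalemxAr -!scalemxAl.
by move: c; rewrite !mxE => ->; ring.
Qed.

Lemma quad_delta S i (v : 'cV[R]_m) :
  ((delta_mx i ord0 : 'cV[R]_m)^T *m S *m v) ord0 ord0 = (row i S *m v) ord0 ord0.
Proof. by rewrite trmx_delta -rowE. Qed.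

Lemma quad_delta2 S i j :
  ((delta_mx i ord0 : 'cV[R]_m)^T *m S *m (delta_mx j ord0 : 'cV[R]_m)) ord0 ord0 = S i j.
Proof. by rewrite quad_delta -colE !mxE. Qed.

Lemma psd_diag S i : psd S -> 0 <= S i i.
Proof. by move=> /psdP[_ /(_ (delta_mx i ord0))]; rewrite quad_delta2. Qed.

(** Otherwise the form takes a negative value at [e_i + e_j] or [e_i - e_j]. *)
Lemma psd_diag0 S : psd S -> (forall i, S i i = 0) -> S = 0.
Proof.
move=> /psdP[sS pS] d; apply/matrixP => i j; rewrite [RHS]mxE.
have h (a : R) : 0 <= - (2 * a * S j i).
  have := pS (delta_mx i ord0 - a *: delta_mx j ord0).
  by rewrite quad_sub// !quad_delta2 !d; lra.
rewrite -sS mxE.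
have := h 1; have := h (- 1); lra.
Qed.

(** One step of Cholesky's algorithm.  The new form at [v] is the old one at
    the vector obtained from [v] by minimizing along the [i]-th axis. *)
Lemma psd_schur S i : psd S -> 0 < S i i ->
  psd (S - (S i i)^-1 *: (col i S *m (col i S)^T)).
Proof.
move=> pS s0; have /psdP[sS qS] := pS; apply/psdP; split.
  by rewrite linearB linearZ /= trmx_mul trmxK sS.
move=> v; set e : 'cV[R]_m := delta_mx i ord0.
set b := (e^T *m S *m v) ord0 ord0.
have := qS (v - (b / S i i) *: e); rewrite quad_sub// -/b /e quad_delta2.
have eb : (v^T *m (col i S *m (col i S)^T) *m v) ord0 ord0 = b ^+ 2.
  have -> : (col i S)^T = e^T *m S by rewrite /e tr_col sS trmx_delta -rowE.
  rewrite mulmxA -mulmxA mxE big_ord1 -/b expr2; congr (_ * _).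
  rewrite /b -[in RHS](trmxK v).
  rewrite -[RHS](mxE trmx_key (fun i j => (e^T *m S *m v^T^T) j i)) -/(trmx _).
  by rewrite !trmx_mul !trmxK sS -colE.
rewrite mulmxBr mulmxBl -scalemxAr -scalemxAl !mxE.
move: eb; rewrite !mxE => ->.
have -> : (b / S i i) ^+ 2 * S i i = b ^+ 2 / S i i.
  by field; rewrite gt_eqF.
by rewrite (_ : 2 * (b / S i i) * b = 2 * (b ^+ 2 / S i i)); [rewrite mulrC; lra|ring].
Qed.

(** By induction on the number of nonzero diagonal entries, which a Cholesky
    step decreases since a psd form with a zero diagonal entry keeps it. *)
Lemma psd_decomp S : psd S -> exists s : seq 'cV[R]_m, S = \sum_(v <- s) v *m v^T.
Proof.
have [n] := ubnP #|[pred i | S i i != 0]|; elim: n S => // n IH S.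
rewrite ltnS => cS pS.
have [i0|/forallPn[i si]] := boolP [forall i, S i i == 0].
  by exists [::]; rewrite big_nil; apply: psd_diag0 => // i; apply/eqP/(forallP i0).
have s0 : 0 < S i i by rewrite lt_def si psd_diag.
have pS' := psd_schur pS s0.
set S' := S - _ in pS'.
have dS' j : S' j j = S j j - (S i i)^-1 * S j i ^+ 2.
  by rewrite /S' !mxE big_ord1 !mxE expr2.
have [|s es] := IH S' _ pS'.
  apply: leq_trans cS; apply: proper_card; apply/properP; split.
    apply/fintype.subsetP => j; rewrite !inE; apply: contra => /eqP sj.
    have := psd_diag j pS'; rewrite dS' sj.
    have : 0 <= (S i i)^-1 * S j i ^+ 2 by rewrite mulr_ge0 ?sqr_ge0// invr_ge0 ltW.
    by move=> ? ?; apply/eqP; lra.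
  exists i; rewrite ?inE// negbK dS'; apply/eqP; field; exact: si.
exists (Num.sqrt (S i i)^-1 *: col i S :: s); rewrite big_cons -es /S'.
rewrite linearZ /= -scalemxAl -scalemxAr scalerA -expr2 sqr_sqrtr ?invr_ge0 ?ltW//.
by rewrite addrC subrK.
Qed.

End PsdMatrices.

(** * Separation from a closed convex cone *)

Section Continuity.
Variables (R : realType) (q : nat).

Lemma continuous_sumr (T : topologicalType) (I : Type) (s : seq I) (F : I -> T -> R) :
  (forall i, continuous (F i)) -> continuous (fun x => \sum_(i <- s) F i x).
Proof.
move=> cF x; elim: s => [|i s IH].
  rewrite (_ : (fun _ => _) = (fun=> 0)); first exact: cvg_cst.
  by apply/funext => y; rewrite big_nil.
rewrite (_ : (fun _ => _) = (fun y => F i y + \sum_(i <- s) F i y)).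
  by apply: cvgD => //; exact: cF.
by apply/funext => y; rewrite big_cons.
Qed.

Lemma continuous_mulmx_coord p (L : 'M[R]_(q, p)) (j : 'I_p) :
  continuous (fun x : 'rV[R]_q => (x *m L) ord0 j).
Proof.
rewrite (_ : (fun _ => _) = (fun x : 'rV[R]_q => \sum_i x ord0 i * L i j)); last first.
  by apply/funext => x; rewrite mxE.
apply: continuous_sumr => i x.
have h : y ord0 i @[y --> x] --> x ord0 i by exact: coord_continuous.
exact: (@cvgMr_tmp _ _ _ _ _ _ (L i j) h).
Qed.

End Continuity.

Section ConeSeparation.
Variables (R : realType).

Definition dot p (u v : 'rV[R]_p) : R := (u *m v^T) ord0 ord0.

Lemma dotE p (u v : 'rV[R]_p) : dot u v = \sum_i u ord0 i * v ord0 i.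
Proof. by rewrite /dot mxE; apply: eq_bigr => i _; rewrite mxE. Qed.

Lemma dotC p (u v : 'rV[R]_p) : dot u v = dot v u.
Proof. by rewrite !dotE; apply: eq_bigr => i _; rewrite mulrC. Qed.

Lemma dotDl p (u v w : 'rV[R]_p) : dot (u + v) w = dot u w + dot v w.
Proof. by rewrite /dot mulmxDl mxE. Qed.

Lemma dotZl p (a : R) (u w : 'rV[R]_p) : dot (a *: u) w = a * dot u w.
Proof. by rewrite /dot -scalemxAl mxE. Qed.

Lemma dotNl p (u w : 'rV[R]_p) : dot (- u) w = - dot u w.
Proof. by rewrite -scaleN1r dotZl mulN1r. Qed.

Lemma dotDr p (u v w : 'rV[R]_p) : dot w (u + v) = dot w u + dot w v.
Proof. by rewrite !(dotC w) dotDl. Qed.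

Lemma dotZr p (a : R) (u w : 'rV[R]_p) : dot w (a *: u) = a * dot w u.
Proof. by rewrite !(dotC w) dotZl. Qed.

Lemma dotNr p (u w : 'rV[R]_p) : dot w (- u) = - dot w u.
Proof. by rewrite !(dotC w) dotNl. Qed.

Lemma dot_ge0 p (u : 'rV[R]_p) : 0 <= dot u u.
Proof. by rewrite dotE sumr_ge0// => i _; rewrite -expr2 sqr_ge0. Qed.

Lemma dot_eq0 p (u : 'rV[R]_p) : dot u u = 0 -> u = 0.
Proof.
rewrite dotE => /eqP; rewrite psumr_eq0 => [/allP h|i _]; last by rewrite -expr2 sqr_ge0.
apply/rowP => i; rewrite mxE; apply/eqP; rewrite -sqrf_eq0 expr2.
by apply: h; rewrite mem_index_enum.
Qed.

Lemma dot_sub p (u v : 'rV[R]_p) (t : R) : dot (u - t *: v) (u - t *: v) =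
  dot u u - 2 * t * dot u v + t ^+ 2 * dot v v.
Proof. by rewrite !(dotDl, dotDr, dotNl, dotNr, dotZl, dotZr) (dotC v u); ring. Qed.

Lemma continuous_dist2 q p (L : 'M[R]_(q, p)) (f : 'rV[R]_p) :
  continuous (fun x : 'rV[R]_q => dot (f - x *m L) (f - x *m L)).
Proof.
rewrite (_ : (fun _ => _) =
  (fun x : 'rV[R]_q => \sum_j (f ord0 j - (x *m L) ord0 j) * (f ord0 j - (x *m L) ord0 j))).
  apply: continuous_sumr => j x.
  have h : f ord0 j - (y *m L) ord0 j @[y --> x] --> f ord0 j - (x *m L) ord0 j.
    have k := @continuous_mulmx_coord R q p L j x.
    exact: (cvgB (cvg_cst (f ord0 j)) k).
  exact: (cvgM h h).
by apply/funext => x; rewrite dotE; apply: eq_bigr => j _; rewrite !mxE.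
Qed.

Section Cone.
Variables (q p : nat) (X : set 'rV[R]_q) (L : 'M[R]_(q, p)).
Hypotheses (Xclosed : closed X) (X0 : X 0).
Hypothesis XD : forall x y, X x -> X y -> X (x + y).
Hypothesis XZ : forall (a : R) x, 0 <= a -> X x -> X (a *: x).
Hypothesis XL : forall x, X x -> x *m L = 0 -> x = 0.

Let closed_norm_le (r : R) : closed [set x : 'rV[R]_q | `|x| <= r].
Proof.
apply: (@preimage_closed _ _ (fun x : 'rV[R]_q => `|x|) [set y | y <= r]).
  by move=> x _; exact: norm_continuous.
exact: closed_le.
Qed.

Let closed_norm_eq (r : R) : closed [set x : 'rV[R]_q | `|x| = r].
Proof.
apply: (@preimage_closed _ _ (fun x : 'rV[R]_q => `|x|) [set y | y = r]).
  by move=> x _; exact: norm_continuous.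
exact: closed_eq.
Qed.

Let min_dist (A : set 'rV[R]_q) (f : 'rV[R]_p) (r : R) : closed A ->
  (forall x, A x -> `|x| <= r) -> A !=set0 ->
  exists2 x, A x & forall y, A y ->
    dot (f - x *m L) (f - x *m L) <= dot (f - y *m L) (f - y *m L).
Proof.
move=> cA bA A0.
have kA : compact A.
  apply: bounded_closed_compact => //; exists r; split; first exact: num_real.
  by move=> y ry x Ax; apply: le_trans (bA _ Ax) (ltW ry).
have [x xA h] := EVT_min_rV A0 kA
  (continuous_subspaceT (@continuous_dist2 q p L f)).
by exists x => [|y Ay]; [exact: set_mem|apply: h; exact: mem_set].
Qed.

(** By compactness of the unit sphere of [X], the map [x |-> x *m L] cannot
    shrink vectors of the cone by more than a fixed factor; this is what makes
    the image of the cone closed. *)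
Let coercive : exists2 d : R, 0 < d &
  forall x, X x -> d * `|x| ^+ 2 <= dot (x *m L) (x *m L).
Proof.
have normZ (a : R) (x : 'rV[R]_q) : 0 <= a -> `|a *: x| = a * `|x|.
  by move=> a0; rewrite normrZ ger0_norm.
have [e|/set0P n0] := eqVneq (X `&` [set x | `|x| = 1]) set0.
  exists 1 => // x Xx.
  have [->|x0] := eqVneq x 0; first by rewrite normr0 expr0n mulr0 dot_ge0.
  have nx : 0 < `|x| by rewrite normr_gt0.
  have : (X `&` [set x | `|x| = 1]) (`|x|^-1 *: x).
    split; first by apply: XZ => //; rewrite invr_ge0.
    by rewrite /= normZ ?invr_ge0// mulVf ?gt_eqF.
  by rewrite e.
have [|x [_ ->]//|x [Xx nx] h] := min_dist 0 _ _ n0 (r := 1).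
  exact: closedI.
have hd y : dot (0 - y *m L) (0 - y *m L) = dot (y *m L) (y *m L).
  by rewrite sub0r dotNl dotNr opprK.
exists (dot (x *m L) (x *m L)).
  rewrite lt_def dot_ge0 andbT; apply/eqP => /dot_eq0 /(XL Xx) x0.
  by move: nx; rewrite /= x0 normr0 => /esym/eqP; rewrite oner_eq0.
move=> y Xy; have [->|y0] := eqVneq y 0.
  by rewrite normr0 expr0n mulr0 dot_ge0.
have ny : 0 < `|y| by rewrite normr_gt0.
have Ay : (X `&` [set x | `|x| = 1]) (`|y|^-1 *: y).
  split; first by apply: XZ => //; rewrite invr_ge0.
  by rewrite /= normZ ?invr_ge0// mulVf ?gt_eqF.
have := h _ Ay; rewrite !hd -scalemxAl dotZl dotZr => hh.
rewrite -ler_pdivlMr ?exprn_gt0//; apply: le_trans hh _.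
by rewrite mulrA -expr2 mulrC exprVn.
Qed.

(** The functional is the one defined by the point of the image nearest to
    [f], which exists by coercivity. *)
Lemma cone_separation (f : 'rV[R]_p) :
  (exists2 x, X x & f = x *m L) \/
  exists u : 'rV[R]_p, (forall x, X x -> 0 <= dot u (x *m L)) /\ dot u f < 0.
Proof.
have [d d0 hd] := coercive.
(* every x in X with |f - x L| <= |f| has d |x|^2 <= |x L|^2 <= 4 |f|^2 *)
set r := 4 * dot f f / d + 1.
have r1 : 1 <= r by rewrite /r lerDr divr_ge0 ?mulr_ge0 ?dot_ge0// ltW.
have small x : X x -> dot (f - x *m L) (f - x *m L) <= dot f f -> `|x| <= r.
  move=> Xx hx; have h1 := hd _ Xx.
  have h2 : dot (x *m L) (x *m L) <= 4 * dot f f.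
    have := dot_ge0 (f + (f - x *m L)).
    move: hx; rewrite !(dotDl, dotDr, dotNl, dotNr) (dotC (x *m L) f).
    by lra.
  have h3 : `|x| ^+ 2 <= r - 1.
    by rewrite /r addrK ler_pdivlMr// mulrC; apply: le_trans h1 h2.
  have := normr_ge0 x; move: h3; nra.
have [|||x [Xx xr] h] := min_dist f (A := X `&` [set x | `|x| <= r]) (r := r).
- exact: closedI.
- by move=> x [].
- by exists 0; split=> //=; rewrite normr0; lra.
set g := f - x *m L in h.
have min y : X y -> dot g g <= dot (f - y *m L) (f - y *m L).
  move=> Xy; have [le|/ltW le] := leP (dot (f - y *m L) (f - y *m L)) (dot f f).
    by apply: h; split=> //; apply: small.
  apply: le_trans le; have := h 0; rewrite mul0mx subr0; apply.
  by split=> //=; rewrite normr0; lra.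
have [g0|g0] := eqVneq (dot g g) 0.
  by left; exists x => //; apply/eqP; rewrite -subr_eq0 -/g (dot_eq0 g0).
have gp : 0 < dot g g by rewrite lt_def g0 dot_ge0.
(* first-order optimality along a ray of admissible directions *)
have opt w : (forall t : R, 0 < t <= 1 -> X (x + t *: w)) -> dot g (w *m L) <= 0.
  move=> hw; rewrite leNgt; apply/negP => pos.
  set a := dot g (w *m L) in pos; set b := dot (w *m L) (w *m L).
  have b0 : 0 <= b by exact: dot_ge0.
  (* for this t the decrease 2 t a exceeds the increase t^2 b *)
  pose t := a / (a + b).
  have t01 : 0 < t <= 1 by rewrite divr_gt0 ?ler_pdivrMr//=; lra.
  have := min _ (hw t t01); rewrite mulmxDl -scalemxAl opprD addrA -/g.
  rewrite dot_sub -/a -/b.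
  have tE : t * (a + b) = a by rewrite mulfVK// gt_eqF//; lra.
  by case/andP: t01; nra.
right; exists (- g); split.
  move=> y Xy; rewrite dotNl oppr_ge0; apply: opt => t /andP[t0 _].
  by apply: XD => //; apply: XZ => //; exact: ltW.
have := opt (- x); rewrite mulNmx dotNr dotNl oppr_le0 oppr_lt0 => hx.
have {}hx : 0 <= dot g (x *m L).
  apply: hx => t /andP[t0 t1]; rewrite scalerN -[X in X - _]scale1r -scalerBl.
  by apply: XZ => //; lra.
have -> : f = g + x *m L by rewrite subrK.
by rewrite dotDr; lra.
Qed.

End Cone.

(** A subspace is the row space of a matrix of maximal rank among those whose
    rows it contains. *)
Lemma subspace_mx p (P : 'rV[R]_p -> Prop) : P 0 ->
  (forall u v, P u -> P v -> P (u + v)) -> (forall (a : R) u, P u -> P (a *: u)) ->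
  exists J : 'M[R]_p, forall u : 'rV[R]_p, P u <-> (u <= J)%MS.
Proof.
move=> P0 PD PZ.
pose good n := `[< exists J : 'M[R]_p, (forall u : 'rV_p, (u <= J)%MS -> P u) /\ \rank J = n >].
have ex : exists n, good n.
  exists 0; apply/asboolP; exists 0; split; last exact: mxrank0.
  by move=> u; rewrite submx0 => /eqP ->.
have ub n : good n -> (n <= p)%N.
  by move=> /asboolP[J [_ <-]]; exact: rank_leq_row.
case: (ex_maxnP ex ub) => n /asboolP[J [hJ rJ]] nmax.
exists J => u; split=> [Pu|]; last exact: hJ.
have /nmax : good (\rank (J + u)%MS).
  apply/asboolP; exists (J + u)%MS; split=> // w /sub_addsmxP[[w1 w2] /= ->].
  apply: PD; first by apply: hJ; exact: submxMl.
  by rewrite [w2]mx11_scalar mul_scalar_mx; exact: PZ.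
rewrite -rJ => hr; have : (J + u <= J)%MS.
  by rewrite -(geq_leqif (mxrank_leqif_sup (addsmxSl J u))).
by apply: submx_trans; exact: addsmxSr.
Qed.

End ConeSeparation.

(** * The closed cone modulo null elements *)

Section StableClosure.
Variables (R : realType) (K : comNzRingType) (C : {rmorphism R -> K}).
Variable M : K -> Prop.
Hypothesis qM : qmodule M.

(** Since squares need not be bounded, [aclos C M] is not closed under
    multiplication by squares; this is its largest part that is. *)
Definition sclos (p : K) : Prop := forall q, aclos C M (q ^+ 2 * p).

(** Null elements form an ideal that is real in the sense of [sclos_Nsqr]. *)
Definition null (p : K) : Prop := sclos p /\ sclos (- p).

Lemma sclos_incl p : M p -> sclos p.
Proof. by move=> Mp q; apply: (aclos_incl C qM); exact: (qmS qM). Qed.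

Lemma sclos_aclos p : sclos p -> aclos C M p.
Proof. by move=> /(_ 1); rewrite expr1n mul1r. Qed.

Lemma sclosD p q : sclos p -> sclos q -> sclos (p + q).
Proof. by move=> hp hq r; rewrite mulrDr; exact: (aclosD qM). Qed.

Lemma sclosS q p : sclos p -> sclos (q ^+ 2 * p).
Proof. by move=> hp r; rewrite mulrA -exprMn. Qed.

Lemma sclos_qmodule : qmodule sclos.
Proof.
split; [|exact: sclosD|by move=> *; exact: sclosS].
by apply: sclos_incl; case: qM.
Qed.

(** [r p] is a combination of [p] and [- p] with square coefficients. *)
Lemma nullM q p : null p -> null (q * p).
Proof.
move=> [h1 h2].
have key r : aclos C M (r * p).
  have -> : r * p = (C 2^-1 * (r + 1)) ^+ 2 * p + (C 2^-1 * (r - 1)) ^+ 2 * - p.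
    transitivity ((C 2^-1 + C 2^-1) ^+ 2 * (r * p)); last by ring.
    by rewrite half_add_half; ring.
  exact: (aclosD qM).
by split=> r; [rewrite mulrA|rewrite -mulNr mulrA]; exact: key.
Qed.

Lemma nullD p q : null p -> null q -> null (p + q).
Proof. by move=> [? ?] [? ?]; split; rewrite ?opprD; exact: sclosD. Qed.

Lemma null0 : null 0.
Proof. by split; rewrite ?oppr0; apply: sclos_incl; exact: (qm0 qM). Qed.

Lemma null_addl p q : sclos p -> sclos q -> null (p + q) -> null p.
Proof.
move=> hp hq [_ h]; split=> //.
by rewrite (_ : - p = - (p + q) + q); [exact: sclosD|ring].
Qed.

(** Completing the square: [r p + s^2] is the square of [s + r p / 2 s] plus a
    multiple of [- p^2]. *)
Lemma sclos_Nsqr p : sclos (- p ^+ 2) -> null p.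
Proof.
move=> h.
have key r : aclos C M (r * p).
  move=> e e0; pose s := Num.sqrt (e / 2).
  have s0 : 0 < s by rewrite sqrtr_gt0; lra.
  have s2 : s ^+ 2 = e / 2 by rewrite sqr_sqrtr//; lra.
  have sC : C s * C s^-1 = 1 by rewrite -rmorphM mulfV ?rmorph1 ?gt_eqF.
  have -> : r * p + C e = (C s + C 2^-1 * C s^-1 * (r * p)) ^+ 2
      + (C ((2 * s) ^- 2) * (r ^+ 2 * - p ^+ 2) + C (e / 2)).
    have -> : C ((2 * s) ^- 2) = (C 2^-1 * C s^-1) ^+ 2.
      by rewrite -rmorphM -rmorphXn -exprVn invfM.
    rewrite [in LHS](_ : e = s ^+ 2 + e / 2); last by rewrite s2; lra.
    transitivity (C s ^+ 2 + (C 2^-1 + C 2^-1) * (C s * C s^-1) * (r * p) + C (e / 2)).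
      by rewrite half_add_half sC; ring.
    by ring.
  apply: (qmD qM); first exact: (qm_sqr qM).
  have c0 : 0 <= (2 * s) ^- 2 by rewrite invr_ge0 sqr_ge0.
  by apply: (aclosZ qM c0 (h r)); lra.
split=> r; first exact: key.
by rewrite mulrN -mulNr; exact: key.
Qed.

End StableClosure.

Section Duality.
Variables (R : realType) (K : comNzRingType) (C : {rmorphism R -> K}).
Variable M : K -> Prop.
Hypothesis qM : qmodule M.
Variables (p k : nat) (l : 'rV[R]_p -> K) (bil : 'rV[R]_k -> 'rV[R]_k -> 'rV[R]_p).
Hypothesis lD : forall u v, l (u + v) = l u + l v.
Hypothesis lZ : forall a u, l (a *: u) = C a * l u.
Hypothesis bilC : forall u v, bil u v = bil v u.
Hypothesis bilD : forall u v w, bil (u + v) w = bil u w + bil v w.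
Hypothesis bilZ : forall a u w, bil (a *: u) w = a *: bil u w.
Hypothesis bilM : forall v w (a b : K),
  M (a ^+ 2 * l (bil v v) + a * b * l (bil v w) *+ 2 + b ^+ 2 * l (bil w w)).

Let l0 : l 0 = 0.
Proof. by rewrite -[0](scale0r (0 : 'rV[R]_p)) lZ rmorph0 mul0r. Qed.

Let bilDr u v w : bil w (u + v) = bil w u + bil w v.
Proof. by rewrite !(bilC w) bilD. Qed.

Let bilZr a u w : bil w (a *: u) = a *: bil w u.
Proof. by rewrite !(bilC w) bilZ. Qed.

Let bil0 w : bil 0 w = 0.
Proof. by rewrite -[X in bil X](scale0r (0 : 'rV[R]_k)) bilZ scale0r. Qed.

Let bil_sumr I (s : seq I) (F : I -> 'rV[R]_k) w :
  bil w (\sum_(i <- s) F i) = \sum_(i <- s) bil w (F i).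
Proof.
by apply: (big_morph (bil w) (fun u v => bilDr u v w)); rewrite bilC bil0.
Qed.

Let bil_suml I (s : seq I) (F : I -> 'rV[R]_k) w :
  bil (\sum_(i <- s) F i) w = \sum_(i <- s) bil (F i) w.
Proof. by rewrite bilC bil_sumr; apply: eq_bigr => i _. Qed.

Let bilM1 v : M (l (bil v v)).
Proof. by have := bilM v 0 1 0; rewrite expr1n expr0n /= !mul1r !mul0r mul0rn !addr0. Qed.

Let bilQ v : sclos C M (l (bil v v)). Proof. exact: sclos_incl. Qed.

Let nullQ := null C M.

(** The facial reduction step.  With [b = l (bil v w)] and
    [c = l (bil w w)], the form at [- (1 + c) / 2 v + b w] equals [- b^2] up to
    a multiple of [l (bil v v)], hence [- b^2] is positive and [b] is null. *)
Lemma null_bil v w : nullQ (l (bil v v)) -> nullQ (l (bil v w)).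
Proof.
move=> nv; apply: (sclos_Nsqr qM).
set b := l (bil v w); set c := l (bil w w).
pose a := - (C 2^-1 * (1 + c)).
have [_ h] := nullM qM (a ^+ 2) nv.
rewrite (_ : - b ^+ 2 = - (a ^+ 2 * l (bil v v)) +
   (a ^+ 2 * l (bil v v) + a * b * b *+ 2 + b ^+ 2 * c)).
  by apply: (sclosD qM h); apply: (sclos_incl C qM); exact: bilM.
have -> : a * b * b *+ 2 = - ((C 2^-1 + C 2^-1) * (1 + c) * b ^+ 2) by rewrite /a; ring.
by rewrite half_add_half; ring.
Qed.

Section Reduced.
Variables (d : nat) (E : 'M[R]_(d, k)) (Z : 'M[R]_p).

Let F (S : 'M[R]_d) : 'rV[R]_p := \sum_i \sum_j S i j *: bil (row i E) (row j E).

Let F_sum (s : seq 'cV[R]_d) : F (\sum_(v <- s) v *m v^T) =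
  \sum_(v <- s) bil (v^T *m E) (v^T *m E).
Proof.
rewrite /F; under eq_bigr do under eq_bigr do rewrite summxE scaler_suml.
under eq_bigr do rewrite exchange_big /=.
rewrite exchange_big /=; apply: eq_bigr => v _.
rewrite {1}mulmx_sum_row bil_suml; apply: eq_bigr => i _.
rewrite mulmx_sum_row bil_sumr; apply: eq_bigr => j _.
by rewrite bilZ bilZr scalerA !mxE big_ord1 !mxE.
Qed.

Let L : 'M[R]_(d * d, p) := \sum_i \sum_j
  delta_mx (mxvec_index i j) ord0 *m (bil (row i E) (row j E) *m Z : 'rV[R]_p).

Let mulL s : s *m L = F (vec_mx s) *m Z.
Proof.
rewrite /L /F mulmx_sumr mulmx_suml; apply: eq_bigr => i _.
rewrite mulmx_sumr mulmx_suml; apply: eq_bigr => j _.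
rewrite mulmxA -colE -scalemxAl [col _ s]mx11_scalar mul_scalar_mx.
by rewrite !mxE.
Qed.

Let X : set 'rV[R]_(d * d) := [set s | psd (vec_mx s)].

Let closed_form (c : 'cV[R]_(d * d)) : closed [set s : 'rV[R]_(d * d) | 0 <= (s *m c) ord0 ord0].
Proof.
apply: (@preimage_closed _ _ (fun s : 'rV[R]_(d * d) => (s *m c) ord0 ord0) [set y | 0 <= y]).
  by move=> x _; exact: continuous_mulmx_coord.
exact: closed_ge.
Qed.

Let entry (i j : 'I_d) : 'cV[R]_(d * d) := delta_mx (mxvec_index i j) ord0.

Let XE : X = (\bigcap_(ij in [set: 'I_d * 'I_d])
    [set s : 'rV[R]_(d * d) | 0 <= (s *m (entry ij.1 ij.2 - entry ij.2 ij.1)) ord0 ord0]) `&`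
  (\bigcap_(v in [set: 'cV[R]_d])
    [set s : 'rV[R]_(d * d) | 0 <= (s *m (mxvec (v *m v^T))^T) ord0 ord0]).
Proof.
have fE s (v : 'cV[R]_d) : (s *m (mxvec (v *m v^T))^T) ord0 ord0 =
    (v^T *m vec_mx s *m v) ord0 ord0.
  rewrite -/(dot s _) dotC /dot.
  by have := mxvec_dotmul (vec_mx s) v^T v^T; rewrite vec_mxK !trmxK => ->.
have dE s i j : (s *m (entry i j - entry j i)) ord0 ord0 =
    (vec_mx s : 'M[R]_d) i j - (vec_mx s : 'M[R]_d) j i.
  by rewrite mulmxBr -!colE !mxE.
apply/seteqP; split=> s /=.
  move=> /psdP[h1 h2]; split=> [[i j] _|v _] /=; last by rewrite fE.
  by rewrite dE -{1}h1 mxE subrr.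
move=> [h1 h2]; apply/psdP; split=> [|v]; last by rewrite -fE; exact: h2.
apply/matrixP => i j; rewrite mxE.
have /= := h1 (i, j) I; have /= := h1 (j, i) I; rewrite !dE; lra.
Qed.

Let Xclosed : closed X.
Proof. by rewrite XE; apply: closedI; apply: closed_bigI => i _; exact: closed_form. Qed.

(** [E] spans the vectors that are kept and [Z] is the quotient map by the
    null affine functions; the hypothesis says that no nonzero psd combination
    vanishes in the quotient. *)
Lemma psd_dual (f : 'rV[R]_p) :
  (forall s : seq 'cV[R]_d,
     (\sum_(v <- s) bil (v^T *m E) (v^T *m E)) *m Z = 0 -> forall v, v \in s -> v = 0) ->
  (exists s : seq 'cV[R]_d,
     (f - \sum_(v <- s) bil (v^T *m E) (v^T *m E)) *m Z = 0) \/
  exists u, (forall v, 0 <= dot u (bil (v *m E) (v *m E) *m Z)) /\ dot u (f *m Z) < 0.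
Proof.
move=> inj.
have [|||||[s /psd_decomp[w ws] fs]|[u [h1 h2]]] := @cone_separation R _ _ X L _ _ _ _ _ (f *m Z).
- exact: Xclosed.
- by rewrite /X /= linear0; exact: psd0.
- by move=> x y hx hy; rewrite /X /= linearD; exact: psdD.
- by move=> a x a0 hx; rewrite /X /= linearZ; exact: psdZ.
- move=> x /psd_decomp[s xs]; rewrite mulL xs F_sum => /inj s0.
  rewrite -[x]vec_mxK xs big_seq big1 ?linear0// => v /s0 ->.
  by rewrite mul0mx.
- left; exists w; rewrite mulmxBl fs mulL ws F_sum subrr //.
- right; exists u; split=> // v.
  have := h1 (mxvec (v^T *m v)); rewrite mulL mxvecK.
  have := F_sum [:: v^T]; rewrite !big_seq1 trmxK => ->; apply.
  by rewrite /X /= mxvecK -{2}[v]trmxK; exact: psd_outer.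
Qed.

End Reduced.

(** Here [l] sends a vector of coefficients to the corresponding linear
    combination in [K].  The vectors [v] with [l (bil v v)] null form a subspace
    by [null_bil]; on a complement of it no sum of positive terms
    [l (bil v v)] is null, so that [cone_separation] applies modulo the null
    combinations.  The functional obtained vanishes on null combinations,
    hence it is nonnegative on every [bil v v]. *)
Theorem sclos_duality (f : 'rV[R]_p) : sclos C M (l f) \/
  exists u, (forall v, 0 <= dot u (bil v v)) /\ dot u f < 0.
Proof.
have [J hJ] : exists J : 'M[R]_p, forall u : 'rV_p, nullQ (l u) <-> (u <= J)%MS.
  apply: subspace_mx; first by rewrite l0; exact: (null0 C qM).
    by move=> u v; rewrite lD; exact: (nullD qM).
  by move=> a u; rewrite lZ; exact: (nullM qM).
have [N hN] : exists N : 'M[R]_k, forall v : 'rV_k,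
    nullQ (l (bil v v)) <-> (v <= N)%MS.
  apply: (@subspace_mx R k (fun v => nullQ (l (bil v v)))).
  - by rewrite bil0 l0; exact: (null0 C qM).
  - move=> u v hu hv; rewrite bilD !bilDr !lD.
    by apply: (nullD qM); apply: (nullD qM) => //; exact: null_bil.
  - by move=> a u hu; rewrite bilZ bilZr !lZ; do 2!apply: (nullM qM).
pose E := row_base (N^C)%MS; pose Z := cokermx J.
have ZJ (u : 'rV_p) : u *m Z = 0 <-> nullQ (l u).
  by rewrite hJ submxE /Z; split=> [->|/eqP].
have l_sum (s : seq 'cV[R]_(\rank (N^C)%MS)) : sclos C M
   (l (\sum_(v <- s) bil (v^T *m E) (v^T *m E))).
  elim/big_rec: _ => [|v u _ hu]; first by rewrite l0; exact: (null0 C qM).1.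
  by rewrite lD; exact: (sclosD qM).
have [|[s /ZJ ns]|[u [h1 h2]]] := @psd_dual _ E Z f.
- elim=> [//|w s IH]; rewrite big_cons => /ZJ; rewrite lD => nws v.
  have ns : nullQ (l (\sum_(v <- s) bil (v^T *m E) (v^T *m E))).
    by apply: null_addl (l_sum s) (bilQ (w^T *m E)) _; rewrite // addrC.
  have nw : nullQ (l (bil (w^T *m E) (w^T *m E))).
    exact: null_addl (bilQ (w^T *m E)) (l_sum s) nws.
  rewrite inE => /predU1P[->|]; last by apply: IH; apply/ZJ.
  have wE : (w^T *m E <= N :&: N^C)%MS.
    rewrite sub_capmx; apply/andP; split; first exact/hN.
    by rewrite -(eq_row_base (N^C)%MS); exact: submxMl.
  move: wE; rewrite capmx_compl submx0 => /eqP w0.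
  apply: trmx_inj; rewrite trmx0; apply: (row_free_inj (row_base_free (N^C)%MS)).
  by rewrite w0 mul0mx.
- left; rewrite -[f](subrK (\sum_(v <- s) bil (v^T *m E) (v^T *m E))) lD.
  by apply: (sclosD qM); [exact: ns.1|exact: l_sum].
- right; exists (u *m Z^T).
  have dZ (g : 'rV_p) : dot (u *m Z^T) g = dot u (g *m Z).
    by rewrite /dot [(g *m Z)^T]trmx_mul mulmxA.
  split=> [v|]; last by rewrite dZ.
  have /sub_addsmxP[[a b] /= ->] : (v <= N + N^C)%MS.
    by apply: submx_full; exact: addsmx_compl_full.
  have /submxP[c bc] : (b *m N^C <= E)%MS.
    by rewrite /E eq_row_base; exact: submxMl.
  have na : nullQ (l (bil (a *m N) (a *m N))) by apply/hN; exact: submxMl.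
  have n0 w : bil (a *m N) w *m Z = 0 by apply/ZJ; exact: null_bil.
  rewrite dZ bilD !bilDr [bil (b *m _) (a *m N)]bilC !mulmxDl !n0 !add0r bc.
  exact: h1.
Qed.

End Duality.

(** * Bounds for symmetric matrices and certificates of distance *)

Section SymmetricBound.
Variables (R : realType).

Lemma quadE m (S : 'M[R]_m) (v : 'cV[R]_m) :
  (v^T *m S *m v) ord0 ord0 = \sum_i \sum_j S i j * (v i ord0 * v j ord0).
Proof.
rewrite mxE exchange_big /=; apply: eq_bigr => j _; rewrite mxE mulr_suml.
by apply: eq_bigr => i _; rewrite mxE; ring.
Qed.

(** The sum of the absolute values of the entries bounds the form, because
    [|v_i v_j| <= |v|^2]. *)
Lemma sym_bound m (S : 'M[R]_m) : S^T = S ->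
  exists2 b : R, 0 < b & psd (b%:M - S) /\ psd (b%:M + S).
Proof.
move=> sS; pose b := 1 + \sum_i \sum_j `|S i j|.
have sb0 : 0 <= \sum_i \sum_j `|S i j| by apply: sumr_ge0 => i _; exact: sumr_ge0.
have key (v : 'cV[R]_m) : `|(v^T *m S *m v) ord0 ord0| <= (v^T *m b%:M *m v) ord0 ord0.
  set N := \sum_i v i ord0 ^+ 2.
  have N0 : 0 <= N by apply: sumr_ge0 => i _; exact: sqr_ge0.
  have vN i : v i ord0 ^+ 2 <= N.
    by rewrite /N (bigD1 i)//= lerDl sumr_ge0// => j _; exact: sqr_ge0.
  have -> : (v^T *m b%:M *m v) ord0 ord0 = b * N.
    rewrite mul_mx_scalar -scalemxAl !mxE; congr (_ * _).
    by apply: eq_bigr => i _; rewrite mxE expr2.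
  apply: (@le_trans _ _ ((\sum_i \sum_j `|S i j|) * N)); last first.
    by rewrite /b mulrDl mul1r; lra.
  rewrite quadE mulr_suml; apply: le_trans (ler_norm_sum _ _ _) _.
  apply: ler_sum => i _; rewrite mulr_suml.
  apply: le_trans (ler_norm_sum _ _ _) _; apply: ler_sum => j _.
  rewrite normrM ler_wpM2l// ler_norml.
  have := vN i; have := vN j.
  have := sqr_ge0 (v i ord0 - v j ord0); have := sqr_ge0 (v i ord0 + v j ord0).
  by move=> h1 h2 h3 h4; apply/andP; split; nra.
exists b; first by rewrite /b; lra.
have ts : (b%:M : 'M[R]_m)^T = b%:M by rewrite tr_scalar_mx.
split; apply/psdP; split=> [|v].
- by rewrite linearB /= ts sS.
- rewrite mulmxBr mulmxBl mxE [X in _ + X]mxE; have := key v; rewrite ler_norml => /andP[]; lra.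
- by rewrite linearD /= ts sS.
- rewrite mulmxDr mulmxDl mxE; have := key v; rewrite ler_norml => /andP[]; lra.
Qed.

Lemma psd_scalar m (c : R) : 0 <= c -> psd (c%:M : 'M[R]_m).
Proof.
move=> c0; apply/psdP; split=> [|v]; first by rewrite tr_scalar_mx.
rewrite mul_mx_scalar -scalemxAl mxE mulr_ge0// mxE sumr_ge0// => i _.
by rewrite mxE -expr2 sqr_ge0.
Qed.

Lemma sym_bound_fam n m (S : 'I_n -> 'M[R]_m) : (forall i, (S i)^T = S i) ->
  exists2 b : R, 0 < b & forall i, psd (b%:M - S i) /\ psd (b%:M + S i).
Proof.
move=> sS; have [b hb] := choice (fun i => let: ex_intro2 b h1 h2 := sym_bound (sS i)
   in ex_intro (fun b => 0 < b /\ (psd (b%:M - S i) /\ psd (b%:M + S i))) b (conj h1 h2)).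
have b0 i : 0 <= b i by have [/ltW] := hb i.
have sb0 : 0 <= \sum_i b i by exact: sumr_ge0.
exists (1 + \sum_i b i); first by lra.
move=> i; have [_ [h1 h2]] := hb i.
have d0 : 0 <= 1 + \sum_i b i - b i.
  have h : b i <= \sum_i b i by rewrite (bigD1 i)//= lerDl sumr_ge0.
  by lra.
have e : (1 + \sum_i b i)%:M = (1 + \sum_i b i - b i)%:M + (b i)%:M :> 'M[R]_m.
  by rewrite -raddfD /= subrK.
by rewrite e; split; rewrite -[X in psd X]addrA; apply: psdD => //; exact: psd_scalar.
Qed.

End SymmetricBound.

Section CoordinateBounds.
Variables (R : realType) (K : comNzRingType) (C : {rmorphism R -> K}) (P : K -> Prop).
Variables (n : nat) (X : 'I_n -> K) (PA : 'rV[R]_n -> Prop) (N : R).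
Hypothesis PAbounded : forall x, PA x -> forall i, `|x ord0 i| <= N.
Hypothesis PApos : forall (c : R) (w : 'rV[R]_n),
  (forall x, PA x -> 0 <= c + dot w x) -> P (C c + \sum_i C (w ord0 i) * X i).

(** [N + X i] and [N - X i] are affine and nonnegative on [PA]. *)
Lemma coordinate_bounds i : P (C N + X i) /\ P (C N - X i).
Proof.
have key (a : R) : `|a| = 1 -> P (C N + C a * X i).
  move=> a1; have := PApos (c := N) (w := a *: delta_mx ord0 i).
  rewrite (bigD1 i)//= big1 => [|j ji]; last first.
    by rewrite !mxE eqxx (negbTE ji) mulr0 rmorph0 mul0r.
  rewrite addr0 !mxE !eqxx mulr1; apply => x PAx.
  rewrite dotZl dotE (bigD1 i)//= big1 => [|j ji]; last first.
    by rewrite !mxE (negbTE ji) mul0r.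
  rewrite addr0 !mxE !eqxx mul1r.
  have := PAbounded PAx i; have : `|a * x ord0 i| = `|x ord0 i| by rewrite normrM a1 mul1r.
  move=> <-; rewrite ler_norml => /andP[]; lra.
split; first by have := key 1; rewrite normr1 rmorph1 mul1r; exact.
by have := key (-1); rewrite normrN1 rmorphN1 mulN1r; exact.
Qed.

End CoordinateBounds.

Section Assembly.
Variables (R : realType) (K : comNzRingType) (C : {rmorphism R -> K}).
Variable M : K -> Prop.
Hypotheses (qM : qmodule M) (aM : arch C M).

Let P := aclos C M.
Let qP : qmodule P. Proof. exact: aclos_qmodule. Qed.
Section DistanceCertificate.
Variables (n : nat) (X : 'I_n -> K) (PA : 'rV[R]_n -> Prop) (N : R).
Hypothesis PAbounded : forall x, PA x -> forall i, `|x ord0 i| <= N.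
Hypothesis PAconvex : forall x y (a : R), 0 <= a <= 1 -> PA x -> PA y ->
  PA (x + a *: (y - x)).
Hypothesis PApos : forall (c : R) (w : 'rV[R]_n),
  (forall x, PA x -> 0 <= c + dot w x) -> P (C c + \sum_i C (w ord0 i) * X i).

Definition dist2 (c : 'rV[R]_n) : K := \sum_i (X i - C (c ord0 i)) ^+ 2.

(** Take [q] almost nearest to [c] in [PA] and [w = q - c].  By convexity
    [dot w (x - q)] is almost nonnegative on [PA], and
    [|x - c|^2 = |x - q|^2 + 2 dot w (x - q) + |w|^2].  If [PA] is empty, then
    [- 1] is positive. *)
Lemma dist2_far (c : 'rV[R]_n) (r : R) : 0 < r ->
  (forall x, PA x -> r <= dot (x - c) (x - c)) -> P (dist2 c - C (r / 2)).
Proof.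
move=> r0 far.
have [[x0 PAx0]|noPA] := pselect (exists x, PA x); last first.
  apply: (qm_all C qP); have := PApos (c := -1) (w := 0).
  rewrite big1 => [|i _]; last by rewrite mxE rmorph0 mul0r.
  rewrite addr0 rmorphN1; apply => x PAx; case: noPA; by exists x.
pose D := [set dot (x - c) (x - c) | x in [set x | PA x]].
have hD : has_inf D.
  split; first by exists (dot (x0 - c) (x0 - c)); exists x0.
  by exists r => _ [x PAx <-]; exact: far.
pose d := n%:R * (2 * N) ^+ 2.
have d0 : 0 <= d by rewrite mulr_ge0 ?ler0n ?sqr_ge0.
have dP x y : PA x -> PA y -> dot (x - y) (x - y) <= d.
  move=> hx hy; rewrite dotE /d mulr_natl -[X in _ *+ X](card_ord n) -sumr_const.
  apply: ler_sum => i _; rewrite !mxE.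
  have := PAbounded hx i; have := PAbounded hy i; rewrite !ler_norml.
  move=> /andP[? ?] /andP[? ?].
  have : 0 <= (2 * N - (x ord0 i - y ord0 i)) * (2 * N + (x ord0 i - y ord0 i)).
    by apply: mulr_ge0; lra.
  by lra.
(* a step so short that s |x - q|^2 is at most r / 4 *)
pose s := r / (4 * (d + r)).
have dr0 : 0 < 4 * (d + r) by lra.
have s0 : 0 < s by rewrite divr_gt0.
have sE : s * (4 * (d + r)) = r by rewrite mulfVK ?gt_eqF.
have s1 : s <= 1 by rewrite ler_pdivrMr//; lra.
have sr0 := mulr_gt0 s0 r0.
have e0 : 0 < s * r / 4 by lra.
(* q misses the infimum by less than s r / 4, which divided by s is again small *)
have [_ [q PAq <-] hq] := inf_adherent e0 hD.
set w := q - c in hq.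
have hh x : PA x -> 0 <= r / 4 - dot w q + dot w x.
  move=> PAx; have Pxs := PAconvex (a := s) _ PAq PAx.
  have : inf D <= dot (q + s *: (x - q) - c) (q + s *: (x - q) - c).
    apply: inf_lbound; first by case: hD.
    by exists (q + s *: (x - q)) => //; apply: Pxs; rewrite (ltW s0).
  rewrite -addrA [s *: _ - c]addrC addrA -/w -[s *: (x - q)]opprK -scaleNr.
  rewrite dot_sub.
  have := dP _ _ PAx PAq; set dd := dot (x - q) (x - q).
  have -> : dot w x = dot w (x - q) + dot w q.
    by rewrite -dotDr subrK.
  move=> hdd h1.
  have h2 : 0 < s * (r / 4 + 2 * dot w (x - q) + s * dd) by nra.
  have := h2; rewrite pmulr_rgt0// => h3.
  have : s * dd <= s * d by rewrite ler_wpM2l// ltW.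
  by nra.
have := PApos hh.
have wr : r <= dot w w by exact: far.
have -> : dist2 c - C (r / 2) = \sum_i (X i - C (q ord0 i)) ^+ 2
   + C 2 * (C (r / 4 - dot w q) + \sum_i C (w ord0 i) * X i) + C (dot w w - r).
  rewrite /dist2.
  have -> : \sum_i (X i - C (c ord0 i)) ^+ 2 = \sum_i (X i - C (q ord0 i)) ^+ 2
     + C 2 * (\sum_i C (w ord0 i) * X i) + \sum_i C (w ord0 i * w ord0 i)
     - C 2 * \sum_i C (w ord0 i * q ord0 i).
    rewrite !mulr_sumr -!big_split /= -sumrB; apply: eq_bigr => i _.
    have -> : c ord0 i = q ord0 i - w ord0 i by rewrite /w !mxE; ring.
    by ring.
  rewrite -!rmorph_sum -!dotE.
  have -> : C (r / 2) = C (r - 2 * (r / 4)) by congr (C _); lra.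
  by ring.
move=> h; apply: (qmD qP); last by apply: (qmC C qP); lra.
apply: (qmD qP); last exact: (qmZ C qP).
by apply: (qm_sum qP) => i; exact: (qm_sqr qP).
Qed.

End DistanceCertificate.

End Assembly.

(** * Certified selection *)

Section Selection.
Variables (R : realType) (K : comNzRingType) (C : {rmorphism R -> K}).
Variable M : K -> Prop.
Hypotheses (qM : qmodule M) (aM : arch C M).

Let P := aclos C M.
Let qP : qmodule P. Proof. exact: aclos_qmodule. Qed.
Let PM a b : P a -> P b -> P (a * b). Proof. exact: aclosM. Qed.

Variables (t : nat) (T : 'M[K]_t -> Prop).
Hypothesis TD : forall G H, T G -> T H -> T (G + H).
Hypothesis TM : forall p (S : 'M[R]_t), M p -> psd S -> T (p *: map_mx C S).

Definition mx_aclos (G : 'M[K]_t) : Prop := forall e : R, 0 < e -> T (G + (C e)%:M).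

(** Matrices that remain approximately in [T] after multiplication by any
    positive weight: they can be averaged by a partition of unity. *)
Definition mx_stable (G : 'M[K]_t) : Prop := forall b, P b -> mx_aclos (b *: G).

Let mapC_scalar (c : R) : map_mx C (c%:M : 'M[R]_t) = (C c)%:M.
Proof. exact: map_scalar_mx. Qed.

(** [p S + e I = (p + e / b) S + (e / b) (b I - S)] for a bound [b] of [S]. *)
Lemma mx_aclos_psd p (S : 'M[R]_t) : P p -> psd S -> mx_aclos (p *: map_mx C S).
Proof.
move=> hp pS e e0.
have [b b0 [hb _]] := sym_bound (proj1 (iffLR (psdP S) pS)).
have -> : p *: map_mx C S + (C e)%:M =
    (p + C (e / b)) *: map_mx C S + 1 *: map_mx C ((e / b) *: (b%:M - S)).
  rewrite map_mxZ map_mxB mapC_scalar; apply/matrixP => i j; rewrite !mxE.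
  have -> : C e = C (e / b) * C b by rewrite -rmorphM mulfVK ?gt_eqF.
  by case: (i == j); rewrite ?mulr1n ?mulr0n; ring.
apply: TD; apply: TM; [|done| |]; first by apply: hp; rewrite divr_gt0.
  by case: qM.
by apply: psdZ => //; rewrite divr_ge0 ?ltW.
Qed.

Lemma mx_aclosD G H : mx_aclos G -> mx_aclos H -> mx_aclos (G + H).
Proof.
move=> hG hH e e0; have -> : G + H + (C e)%:M = (G + (C (e / 2))%:M) + (H + (C (e / 2))%:M).
  rewrite [in LHS](_ : e = e / 2 + e / 2); last by lra.
  by rewrite rmorphD raddfD /= addrACA.
by apply: TD; [apply: hG|apply: hH]; lra.
Qed.

Lemma mx_stable_psd p (S : 'M[R]_t) : P p -> psd S -> mx_stable (p *: map_mx C S).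
Proof. by move=> hp pS b hb; rewrite scalerA; apply: mx_aclos_psd => //; exact: PM. Qed.

Lemma mx_stableD G H : mx_stable G -> mx_stable H -> mx_stable (G + H).
Proof. by move=> hG hH b hb; rewrite scalerDr; apply: mx_aclosD; [exact: hG|exact: hH]. Qed.

Lemma mx_stableZ b G : P b -> mx_stable G -> mx_stable (b *: G).
Proof. by move=> hb hG c hc; rewrite scalerA; apply: hG; exact: PM. Qed.

Lemma mx_stable_scalar p : P p -> mx_stable p%:M.
Proof.
move=> hp; rewrite -[p]mulr1 -scale_scalar_mx -(rmorph1 C) -mapC_scalar.
by apply: mx_stable_psd => //; apply: psd_scalar; exact: ler01.
Qed.

Lemma mx_stable0 : mx_stable 0.
Proof. by rewrite -(raddf0 (@scalar_mx K t)); apply: mx_stable_scalar; exact: (qm0 qP). Qed.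

Lemma mx_stable_sum (J : finType) (F : J -> 'M[K]_t) :
  (forall j, mx_stable (F j)) -> mx_stable (\sum_j F j).
Proof. by move=> h; apply: big_ind => //; [exact: mx_stable0|exact: mx_stableD]. Qed.

(** [2 (u S + g b I) = (g + u) (b I + S) + (g - u) (b I - S)]. *)
Lemma mx_stable_bound (u g : K) (b : R) (S : 'M[R]_t) :
  P (g + u) -> P (g - u) -> psd (b%:M - S) -> psd (b%:M + S) ->
  mx_stable (u *: map_mx C S + (g * C b)%:M).
Proof.
move=> h1 h2 s1 s2.
have -> : u *: map_mx C S + (g * C b)%:M =
    (C 2^-1 * (g + u)) *: map_mx C (b%:M + S) + (C 2^-1 * (g - u)) *: map_mx C (b%:M - S).
  rewrite map_mxD map_mxB mapC_scalar; apply/matrixP => i j; rewrite !mxE.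
  transitivity ((C 2^-1 + C 2^-1) * (u * C (S i j) + (g * C b) *+ (i == j))).
    by rewrite half_add_half mul1r.
  by case: (i == j); rewrite ?mulr1n ?mulr0n; ring.
by apply: mx_stableD; apply: mx_stable_psd => //; apply: (qmZ C qP) => //; rewrite invr_ge0 ler0n.
Qed.

Variables (n s : nat) (X : 'I_n -> K) (PA : 'rV[R]_n -> Prop) (N : R).
Hypothesis PAbounded : forall x, PA x -> forall i, `|x ord0 i| <= N.
Hypothesis PAconvex : forall x y (a : R), 0 <= a <= 1 -> PA x -> PA y ->
  PA (x + a *: (y - x)).
Hypothesis PApos : forall (c : R) (w : 'rV[R]_n),
  (forall x, PA x -> 0 <= c + dot w x) -> P (C c + \sum_i C (w ord0 i) * X i).

Variables (B0 : 'M[R]_t) (Bx : 'I_n -> 'M[R]_t) (Bz : 'I_s -> 'M[R]_t).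
Hypotheses (hB0 : B0^T = B0) (hBx : forall i, (Bx i)^T = Bx i).

Definition pencil_at (z : 'I_s -> K) : 'M[K]_t := map_mx C B0 +
  \sum_i X i *: map_mx C (Bx i) + \sum_j z j *: map_mx C (Bz j).

Let Xbound i := coordinate_bounds PAbounded PApos i.

Lemma pencil_lower_bound : exists2 mu : R, 0 < mu &
  mx_stable (pencil_at (fun=> 0) + (C mu)%:M).
Proof.
have [b0 b00 [_ hb0]] := sym_bound hB0.
have [b bp hb] := sym_bound_fam hBx.
exists (b0 + n%:R * (`|N| + 1) * b).
  have : 0 <= n%:R * (`|N| + 1) * b :> R.
    by rewrite !mulr_ge0 ?ler0n// ?ltW//; have := normr_ge0 N; lra.
  by lra.
have -> : pencil_at (fun=> 0) + (C (b0 + n%:R * (`|N| + 1) * b))%:M =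
   1 *: map_mx C (b0%:M + B0) + \sum_i (X i *: map_mx C (Bx i) + (C (`|N| + 1) * C b)%:M).
  rewrite /pencil_at [X in _ + _ + X + _]big1 => [|j _]; last by rewrite scale0r.
  rewrite addr0 big_split /= sumr_const card_ord scale1r map_mxD mapC_scalar.
  rewrite rmorphD raddfD /= -raddfMn /=.
  have -> : C (n%:R * (`|N| + 1) * b) = (C (`|N| + 1) * C b) *+ n.
    by rewrite !rmorphM rmorph_nat mulr_natl mulrnAl.
  by rewrite addrACA [X in X + _]addrC.
apply: mx_stableD; first by apply: mx_stable_psd => //; case: qP.
apply: mx_stable_sum => i; have [h1 h2] := hb i; have [X1 X2] := Xbound i.
have c0 : P (C (`|N| + 1 - N)) by apply: (qmC C qP); have := ler_norm N; lra.
apply: mx_stable_bound => //.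
- by rewrite (_ : _ + X i = C (`|N| + 1 - N) + (C N + X i)); [exact: (qmD qP)|ring].
- by rewrite (_ : _ - X i = C (`|N| + 1 - N) + (C N - X i)); [exact: (qmD qP)|ring].
Qed.

(** Each error term [(X i - x i) Bx i] is at least
    [- (th + (X i - x i)^2 / (4 th)) b I], and
    [(X i - x i)^2 <= 2 (X i - c i)^2 + 2 (c i - x i)^2]. *)
Lemma pencil_near (b : R) (x c : 'rV[R]_n) (z : 'rV[R]_s) (eps th : R) :
  (forall i, psd (b%:M - Bx i) /\ psd (b%:M + Bx i)) ->
  0 < b -> 0 < th -> loewner_ge (pencil B0 Bx Bz x z) eps%:M ->
  mx_stable (pencil_at (fun j => C (z ord0 j))
    + (C (b / (2 * th)) * dist2 C X c
       + C (n%:R * (th * b) + b / (2 * th) * dot (c - x) (c - x) - eps))%:M).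
Proof.
move=> hb b0 th0 psz.
pose u i := X i - C (x ord0 i); pose v i := X i - C (c ord0 i).
pose w i := c ord0 i - x ord0 i.
have th4 : 0 < 4 * th by lra.
pose g i := C th + C (4 * th)^-1 * u i ^+ 2.
have -> : pencil_at (fun j => C (z ord0 j)) + (C (b / (2 * th)) * dist2 C X c
       + C (n%:R * (th * b) + b / (2 * th) * dot (c - x) (c - x) - eps))%:M =
   1 *: map_mx C (pencil B0 Bx Bz x z - eps%:M) +
   \sum_i (u i *: map_mx C (Bx i) + (g i * C b)%:M) +
   (\sum_i C (b / (4 * th)) * (v i - C (w i)) ^+ 2)%:M.
  rewrite scale1r /pencil_at /pencil big_split /= -raddf_sum /=.
  have -> : C (b / (2 * th)) * dist2 C X c
       + C (n%:R * (th * b) + b / (2 * th) * dot (c - x) (c - x) - eps) =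
     - C eps + (\sum_i g i * C b + \sum_i C (b / (4 * th)) * (v i - C (w i)) ^+ 2).
    have -> : C (n%:R * (th * b) + b / (2 * th) * dot (c - x) (c - x) - eps) =
       - C eps + (\sum_(i < n) C (th * b) + C (b / (2 * th)) * \sum_i C (w i * w i)).
      rewrite sumr_const card_ord -[C (th * b) *+ n]mulr_natl -(rmorph_nat C) -(rmorph_sum C).
      have -> : dot (c - x) (c - x) = \sum_i (w i * w i).
        by rewrite dotE; apply: eq_bigr => i _; rewrite !mxE.
      by ring.
    rewrite addrCA; congr (_ + _); rewrite /dist2 !mulr_sumr -!big_split /=.
    apply: eq_bigr => i _; rewrite /g -/(v i).
    have -> : u i = v i + C (w i) by rewrite /u /v /w; ring.
    have -> : C (b / (4 * th)) = C (4 * th)^-1 * C b by rewrite mulrC -rmorphM.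
    have -> : C (b / (2 * th)) = (C (4 * th)^-1 * C b) *+ 2.
      rewrite -rmorphM -rmorphMn; congr (C _).
      by field; rewrite gt_eqF.
    by ring.
  apply/matrixP => i j; rewrite !map_mxB !map_mxD mapC_scalar !raddf_sum /=.
  rewrite !mxE !summxE.
  have -> : \sum_k (X k *: map_mx C (Bx k)) i j =
     \sum_k (map_mx C (x ord0 k *: Bx k)) i j + \sum_k (u k *: map_mx C (Bx k)) i j.
    by rewrite -big_split /=; apply: eq_bigr => k _; rewrite !mxE /u; ring.
  have -> : \sum_k (C (z ord0 k) *: map_mx C (Bz k)) i j =
     \sum_k (map_mx C (z ord0 k *: Bz k)) i j.
    by apply: eq_bigr => k _; rewrite !mxE; ring.
  have sumM (F : 'I_n -> K) : \sum_k (F k)%:M i j = (\sum_k F k) *+ (i == j).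
    by rewrite -sumrMnl; apply: eq_bigr => k _; rewrite mxE.
  by rewrite !sumM; case: (i == j); rewrite ?mulr1n ?mulr0n; ring.
apply: mx_stableD; first apply: mx_stableD.
- by apply: mx_stable_psd => //; case: qP.
- apply: mx_stable_sum => i; have [h1 h2] := hb i.
  have sq (a : R) : `|a| = 1 -> P (g i + C a * u i).
    move=> a1; have a2 : a ^+ 2 = 1 by rewrite -real_normK ?num_real// a1 expr1n.
    pose r := Num.sqrt th.
    have r2 : r ^+ 2 = th by rewrite sqr_sqrtr// ltW.
    have r0 : 0 < r by rewrite sqrtr_gt0.
    have -> : g i + C a * u i = (C r + C (a / (2 * r)) * u i) ^+ 2.
      rewrite /g (_ : (4 * th)^-1 = (a / (2 * r)) ^+ 2); last first.
        by rewrite expr_div_n a2 exprMn r2; field; rewrite gt_eqF.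
      rewrite [in LHS](_ : C a = C (2 * (r * (a / (2 * r))))); last first.
        by congr (C _); field; rewrite gt_eqF.
      by rewrite -r2; ring.
    exact: (qm_sqr qP).
  apply: mx_stable_bound => //.
  - by have := sq 1; rewrite normr1 rmorph1 mul1r; exact.
  - by have := sq (-1); rewrite normrN1 rmorphN1 mulN1r; exact.
- apply: mx_stable_scalar; apply: (qm_sum qP) => i.
  apply: (qmZ C qP); last exact: (qm_sqr qP).
  by rewrite divr_ge0// ltW.
Qed.

Let dist2_ge0 c : P (dist2 C X c).
Proof. by apply: (qm_sum qP) => i; exact: (qm_sqr qP). Qed.

(** [th] and [r] are tuned so that the constant error terms of [pencil_near]
    add up to at most [eps / 2] when [|c - x|^2 < r]; for the other points [c]
    the second summand of [kappa] compensates the lower bound of [B(X, 0)]. *)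
Lemma pencil_pointwise (eps : R) : 0 < eps ->
  (forall x, PA x -> exists z : 'rV[R]_s, loewner_ge (pencil B0 Bx Bz x z) eps%:M) ->
  exists2 kappa : R, 0 < kappa & forall c : 'rV[R]_n, exists z : 'rV[R]_s,
    mx_stable (pencil_at (fun j => C (z ord0 j)) +
      (C kappa * dist2 C X c - C (eps / 2))%:M).
Proof.
move=> eps0 hz; have [b b0 hb] := sym_bound_fam hBx.
have [mu mu0 hmu] := pencil_lower_bound.
have nb : 0 <= n%:R * b :> R by rewrite mulr_ge0 ?ler0n ?ltW.
pose th := eps / (4 * (n%:R * b + 1)).
have th0 : 0 < th by rewrite divr_gt0//; lra.
have thE : th * (4 * (n%:R * b + 1)) = eps by rewrite mulfVK// gt_eqF//; lra.
clearbody th.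
pose r := eps * th / (2 * b).
have r0 : 0 < r by rewrite divr_gt0 ?mulr_gt0//; lra.
have rE : b / (2 * th) * r = eps / 4.
  by rewrite /r; field; rewrite !gt_eqF.
clearbody r.
have k1 : 0 < b / (2 * th) by rewrite divr_gt0//; lra.
have k2 : 0 < (2 * mu + eps) / r by rewrite divr_gt0//; lra.
exists (b / (2 * th) + (2 * mu + eps) / r); first by lra.
move=> c; have [[x [PAx xc]]|far] :=
    pselect (exists x, PA x /\ dot (c - x) (c - x) < r).
  have [z hzx] := hz x PAx; exists z.
  have h := pencil_near c hb b0 th0 hzx.
  have d0 := dot_ge0 (c - x).
  set p := (X in _ + X%:M); set q := (X in _ + X%:M) in h.
  have -> : p = q + (C ((2 * mu + eps) / r) * dist2 C X c + C (eps / 2 -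
      (n%:R * (th * b) + b / (2 * th) * dot (c - x) (c - x)))).
    rewrite /p /q.
    transitivity (C (b / (2 * th) + (2 * mu + eps) / r) * dist2 C X c + C (eps / 2) - C eps);
      last by ring.
    have -> : C eps = C (eps / 2) + C (eps / 2).
      by rewrite -rmorphD; congr (C _); lra.
    by ring.
  rewrite raddfD /= addrA; apply: mx_stableD => //; apply: mx_stable_scalar.
  apply: (qmD qP); first by apply: (qmZ C qP) => //; exact: ltW.
  apply: (qmC C qP).
  have : b / (2 * th) * dot (c - x) (c - x) <= b / (2 * th) * r.
    by rewrite ler_wpM2l// ltW.
  by rewrite rE; nra.
exists 0; have hfar : P (dist2 C X c - C (r / 2)).
  apply: (dist2_far qM aM PAbounded PAconvex PApos r0) => x PAx.
  rewrite leNgt; apply/negP => h; apply: far; exists x; split=> //.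
  by rewrite -opprB dotNl dotNr opprK.
have -> : pencil_at (fun j => C ((0 : 'rV[R]_s) ord0 j)) = pencil_at (fun=> 0).
  by rewrite /pencil_at; congr (_ + _); apply: eq_bigr => j _; rewrite mxE rmorph0.
have kE : (2 * mu + eps) / r * (r / 2) = mu + eps / 2.
  by field; rewrite gt_eqF.
have -> : C (b / (2 * th) + (2 * mu + eps) / r) * dist2 C X c - C (eps / 2) =
    C mu + (C (b / (2 * th)) * dist2 C X c +
      C ((2 * mu + eps) / r) * (dist2 C X c - C (r / 2))).
  rewrite [in RHS]mulrBr -[C _ * C (r / 2)]rmorphM kE.
  by ring.
rewrite raddfD /= addrA; apply: mx_stableD => //; apply: mx_stable_scalar.
by apply: (qmD qP); apply: (qmZ C qP) => //; exact: ltW.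
Qed.

(** The weights sum to one and the pencil is affine in [z]. *)
Lemma pencil_at_average (J : finType) (b : J -> K) (z : J -> 'I_s -> K) :
  \sum_j b j = 1 ->
  pencil_at (fun i => \sum_j b j * z j i) = \sum_j b j *: pencil_at (z j).
Proof.
move=> b1; rewrite /pencil_at.
under [RHS]eq_bigr do rewrite scalerDr.
rewrite big_split /= -scaler_suml b1 scale1r; congr (_ + _).
under [RHS]eq_bigr do rewrite scaler_sumr.
rewrite exchange_big /=; apply: eq_bigr => i _.
by rewrite scaler_suml; apply: eq_bigr => j _; rewrite scalerA.
Qed.

Theorem certified_selection :
  (exists2 eps : R, 0 < eps & forall x, PA x ->
     exists z : 'rV[R]_s, loewner_ge (pencil B0 Bx Bz x z) eps%:M) ->
  exists z : 'I_s -> K, T (pencil_at z).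
Proof.
move=> [eps eps0 hz]; have [kappa k0 hk] := pencil_pointwise eps0 hz.
(* the n variances add up to n e, and kappa n e is at most eps / 4, half of the
   margin of pencil_pointwise *)
pose e := eps / (4 * kappa * (n%:R + 1)).
have n1 : 0 < n%:R + 1 :> R by have : 0 <= n%:R :> R by exact: ler0n.
have e0 : 0 < e by rewrite divr_gt0 ?mulr_gt0.
have eE : kappa * (n%:R * e) <= eps / 4.
  have : kappa * ((n%:R + 1) * e) = eps / 4.
    by rewrite /e; field; rewrite !gt_eqF.
  by have := mulr_gt0 k0 e0; lra.
have [J [b [c [b0 b1 bV]]]] := partition_of_unity qM aM X e0.
have [z hzc] := choice (fun j => hk (\row_i c j i)).
exists (fun i => \sum_j b j * C (z j ord0 i)).
have V : P (C (n%:R * e) - \sum_j b j * dist2 C X (\row_i c j i)).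
  have -> : C (n%:R * e) - \sum_j b j * dist2 C X (\row_i c j i) =
      \sum_i (C e - \sum_j b j * (X i - C (c j i)) ^+ 2).
    rewrite sumrB sumr_const card_ord rmorphM rmorph_nat mulr_natl; congr (_ - _).
    rewrite exchange_big /=; apply: eq_bigr => j _; rewrite /dist2 mulr_sumr.
    by apply: eq_bigr => i _; rewrite mxE.
  exact: (qm_sum qP).
have hG : mx_stable (pencil_at (fun i => \sum_j b j * C (z j ord0 i)) - (C (eps / 4))%:M).
  rewrite pencil_at_average//.
  have -> : \sum_j b j *: pencil_at (fun i => C (z j ord0 i)) - (C (eps / 4))%:M =
    \sum_j b j *: (pencil_at (fun i => C (z j ord0 i)) +
      (C kappa * dist2 C X (\row_i c j i) - C (eps / 2))%:M) +
    (C kappa * (C (n%:R * e) - \sum_j b j * dist2 C X (\row_i c j i)) +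
     C (eps / 4 - kappa * (n%:R * e)))%:M.
    under [in RHS]eq_bigr do rewrite scalerDr scale_scalar_mx.
    rewrite [in RHS]big_split /= -[in RHS]addrA; congr (_ + _).
    rewrite -raddf_sum -raddfD -raddfN /=; congr (_%:M).
    have -> : \sum_j b j * (C kappa * dist2 C X (\row_i c j i) - C (eps / 2)) =
        C kappa * (\sum_j b j * dist2 C X (\row_i c j i)) - C (eps / 2).
      rewrite -[C (eps / 2) in RHS]mul1r -[in RHS]b1 mulr_suml mulr_sumr -sumrB.
      by apply: eq_bigr => j _; ring.
    have -> : C (eps / 2) = C (eps / 4) + C (eps / 4).
      by rewrite -rmorphD; congr (C _); lra.
    by ring.
  apply: mx_stableD; first by apply: mx_stable_sum => j; exact: mx_stableZ (b0 j) (hzc j).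
  apply: mx_stable_scalar; apply: (qmD qP); first by apply: (qmZ C qP) => //; exact: ltW.
  by apply: (qmC C qP); lra.
have := hG 1; rewrite scale1r => /(_ (let: And3 h _ _ := qP in h)) /(_ (eps / 4)).
by rewrite subrK; apply; rewrite divr_gt0.
Qed.

End Selection.

(** * Duality for linear pencils *)

Section LinearCombinations.
Variables (R : realType) (K : comNzRingType) (C : {rmorphism R -> K}).
Variable M : K -> Prop.
Hypothesis qM : qmodule M.
Variables (p k : nat) (A : 'I_p -> 'M[R]_k) (g : 'I_p -> K).
Hypothesis As : forall j, (A j)^T = A j.
Let AK : 'M[K]_k := \sum_j g j *: map_mx C (A j).
Hypothesis AM : forall w : 'cV[K]_k, M ((w^T *m AK *m w) ord0 ord0).

Let l (u : 'rV[R]_p) : K := \sum_j C (u ord0 j) * g j.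
Let bil (v w : 'rV[R]_k) : 'rV[R]_p := \row_j (v *m A j *m w^T) ord0 ord0.

Let AK_bil v w : (map_mx C v *m AK *m (map_mx C w)^T) ord0 ord0 = l (bil v w).
Proof.
rewrite /AK mulmx_sumr mulmx_suml summxE /l; apply: eq_bigr => j _.
by rewrite -scalemxAr -scalemxAl mxE map_trmx -!map_mxM !mxE mulrC.
Qed.

Lemma linear_duality (f : 'rV[R]_p) : sclos C M (\sum_j C (f ord0 j) * g j) \/
  exists u : 'rV[R]_p,
    (forall v : 'rV[R]_k, 0 <= (v *m (\sum_j u ord0 j *: A j) *m v^T) ord0 ord0)
    /\ dot u f < 0.
Proof.
have lD u v : l (u + v) = l u + l v.
  by rewrite /l -big_split /=; apply: eq_bigr => j _; rewrite mxE rmorphD mulrDl.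
have lZ a u : l (a *: u) = C a * l u.
  by rewrite /l mulr_sumr; apply: eq_bigr => j _; rewrite mxE rmorphM mulrA.
have bilC u v : bil u v = bil v u.
  apply/rowP => j; rewrite !mxE.
  have h : (u *m A j *m v^T)^T = v *m A j *m u^T by rewrite !trmx_mul trmxK As mulmxA.
  by have := congr1 (fun x : 'M[R]_1 => x ord0 ord0) h; rewrite !mxE.
have bilD u v w : bil (u + v) w = bil u w + bil v w.
  by apply/rowP => j; rewrite mxE !mulmxDl !mxE.
have bilZ a u w : bil (a *: u) w = a *: bil u w.
  by apply/rowP => j; rewrite mxE -!scalemxAl !mxE.
have bilM v w (a b : K) :
  M (a ^+ 2 * l (bil v v) + a * b * l (bil v w) *+ 2 + b ^+ 2 * l (bil w w)).
  have := AM (a *: (map_mx C v)^T + b *: (map_mx C w)^T).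
  have -> : (a *: (map_mx C v)^T + b *: (map_mx C w)^T)^T = a *: map_mx C v + b *: map_mx C w.
    by rewrite linearD /= !linearZ /= !trmxK.
  rewrite !(mulmxDl, mulmxDr) -!(scalemxAl, scalemxAr).
  have addE (x y : 'M[K]_1) : (x + y) ord0 ord0 = x ord0 ord0 + y ord0 ord0 by rewrite mxE.
  have scaleE c (x : 'M[K]_1) : (c *: x) ord0 ord0 = c * x ord0 ord0 by rewrite mxE.
  rewrite !(addE, scaleE) !AK_bil (bilC w v).
  by congr (M _); ring.
have [h|[u [h1 h2]]] := sclos_duality qM lD lZ bilC bilD bilZ bilM f; first by left.
right; exists u; split=> // v; have := h1 v.
rewrite dotE mulmx_sumr mulmx_suml summxE.
suff -> : \sum_i (v *m (u ord0 i *: A i) *m v^T) ord0 ord0 =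
   \sum_i u ord0 i * bil v v ord0 i by [].
by apply: eq_bigr => j _; rewrite -scalemxAr -scalemxAl !mxE.
Qed.

End LinearCombinations.

Section PencilDuality.
Variables (R : realType) (n r k : nat).
Variables (A0 : 'M[R]_k) (Ax : 'I_n -> 'M[R]_k) (Ay : 'I_r -> 'M[R]_k).
Hypotheses (hA0 : A0^T = A0) (hAx : forall i, (Ax i)^T = Ax i)
  (hAy : forall j, (Ay j)^T = Ay j).

(** Families indexed by the coefficients of an affine function in the
    variables [x] and [y]: the constant one, then those of [x], then those of
    [y]. *)
Definition by_block (T : Type) (a : T) (b : 'I_n -> T) (c : 'I_r -> T)
    (j : 'I_(1 + (n + r))) : T :=
  match fintype.split j with
  | inl _ => a
  | inr i => match fintype.split i with inl i => b i | inr i => c i end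
  end.

Lemma sum_by_block (V : nmodType) (F : 'I_(1 + (n + r)) -> V) : \sum_j F j =
  F (lshift (n + r) ord0) + \sum_i F (rshift 1 (lshift r i))
    + \sum_i F (rshift 1 (rshift n i)).
Proof. by rewrite big_split_ord big_ord1 big_split_ord /= addrA. Qed.

Lemma by_block_0 (T : Type) (a : T) b c : by_block a b c (lshift (n + r) ord0) = a.
Proof. by rewrite /by_block (unsplitK (inl ord0)). Qed.

Lemma by_block_x (T : Type) (a : T) b c i : by_block a b c (rshift 1 (lshift r i)) = b i.
Proof. by rewrite /by_block (unsplitK (inr (lshift r i))) (unsplitK (inl i)). Qed.

Lemma by_block_y (T : Type) (a : T) b c i : by_block a b c (rshift 1 (rshift n i)) = c i.
Proof. by rewrite /by_block (unsplitK (inr (rshift n i))) (unsplitK (inr i)). Qed.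

Definition by_blockE := (by_block_0, by_block_x, by_block_y).

(** The homogenization of the pencil, linear in [(a, x, y)]. *)
Definition homog (a : R) (x : 'rV[R]_n) (y : 'rV[R]_r) : 'M[R]_k :=
  a *: A0 + \sum_i x ord0 i *: Ax i + \sum_j y ord0 j *: Ay j.

Lemma pencil_homog x y : pencil A0 Ax Ay x y = homog 1 x y.
Proof. by rewrite /pencil /homog scale1r. Qed.

Lemma homogD a a' x x' y y' (c : R) :
  homog (a + c * a') (x + c *: x') (y + c *: y') = homog a x y + c *: homog a' x' y'.
Proof.
rewrite /homog !scalerDr addrACA scalerDl scalerA; congr (_ + _).
  rewrite addrACA; congr (_ + _).
  rewrite scaler_sumr -big_split /=; apply: eq_bigr => i _.
  by rewrite !mxE scalerDl scalerA.
rewrite scaler_sumr -big_split /=; apply: eq_bigr => i _.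
by rewrite !mxE scalerDl scalerA.
Qed.

Lemma homogZ a x y (c : R) : homog (c * a) (c *: x) (c *: y) = c *: homog a x y.
Proof.
have := homogD 0 a 0 x 0 y c; rewrite !add0r => ->.
have -> : homog 0 0 0 = 0.
  by rewrite /homog scale0r add0r !big1 ?addr0// => i _; rewrite mxE scale0r.
by rewrite add0r.
Qed.

Definition projection (x : 'rV[R]_n) : Prop :=
  exists y : 'rV[R]_r, psd (pencil A0 Ax Ay x y).

Lemma projection_convex x x' (c : R) : 0 <= c <= 1 ->
  projection x -> projection x' -> projection (x + c *: (x' - x)).
Proof.
move=> /andP[c0 c1] [y hy] [y' hy']; exists (y + c *: (y' - y)).
have comb m (v v' : 'rV[R]_m) : v + c *: (v' - v) = (1 - c) *: v + c *: v'.
  by rewrite scalerBr scalerBl scale1r addrA addrAC.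
have e : 1 = (1 - c) * 1 + c * 1 :> R by ring.
rewrite pencil_homog !comb {1}e homogD homogZ -!pencil_homog.
by apply: psdD; apply: psdZ => //; lra.
Qed.

Variables (K : comNzRingType) (C : {rmorphism R -> K}) (M : K -> Prop).
Hypothesis qM : qmodule M.
Variables (gx : 'I_n -> K) (gy : 'I_r -> K).
Let AK : 'M[K]_k := map_mx C A0 + \sum_i gx i *: map_mx C (Ax i)
   + \sum_j gy j *: map_mx C (Ay j).
Hypothesis AM : forall w : 'cV[K]_k, M ((w^T *m AK *m w) ord0 ord0).

(** The direct sum of the scalar [1] and the pencil, so that the constants and
    the forms [v^T A v] are values of a single quadratic form. *)
Let A1 j : 'M[R]_(1 + k) :=
  block_mx (by_block 1 (fun=> 0) (fun=> 0) j)%:M 0 0 (by_block A0 Ax Ay j).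
Let g1 := by_block 1 gx gy.

Lemma augmented_form (L : comNzRingType) (D : {rmorphism R -> L})
   (h : 'I_(1 + (n + r)) -> L) (a : 'M[L]_1) (w : 'cV[L]_k) :
  (col_mx a w)^T *m (\sum_j h j *: map_mx D (A1 j)) *m col_mx a w =
  h (lshift (n + r) ord0) *: (a^T *m a) +
  w^T *m (\sum_j h j *: map_mx D (by_block A0 Ax Ay j)) *m w.
Proof.
have e j : (col_mx a w)^T *m (h j *: map_mx D (A1 j)) *m col_mx a w =
    h j *: ((D (by_block 1 (fun=> 0) (fun=> 0) j)) *: (a^T *m a)) +
    w^T *m (h j *: map_mx D (by_block A0 Ax Ay j)) *m w.
  rewrite /A1 map_block_mx !map_mx0 map_scalar_mx -!scalemxAr -!scalemxAl -scalerDr.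
  rewrite tr_col_mx mul_row_block mul_row_col !mulmx0 addr0 add0r.
  by rewrite mul_mx_scalar -scalemxAl.
rewrite !mulmx_sumr !mulmx_suml (eq_bigr _ (fun j _ => e j)) big_split /=.
congr (_ + _); rewrite sum_by_block !by_blockE rmorph1 scale1r.
rewrite !big1 ?addr0// => i _; by rewrite by_blockE rmorph0 scale0r scaler0.
Qed.

(** A separating functional is a nonnegative multiple of the evaluation at a
    point of the spectrahedron, or a direction of recession of it; both
    contradict the sign of the affine function, when the spectrahedron is not
    empty.  When it is empty, the alternative applied to [- 1] shows that
    everything is positive. *)
Lemma pencil_duality (c : R) (w : 'rV[R]_n) :
  (forall x, projection x -> 0 <= c + dot w x) ->
  sclos C M (C c + \sum_i C (w ord0 i) * gx i).
Proof.
have A1s j : (A1 j)^T = A1 j.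
  rewrite /A1 tr_block_mx tr_scalar_mx !trmx0; congr block_mx.
  by rewrite /by_block; case: fintype.split => // i; case: fintype.split.
have A1M (v : 'cV[K]_(1 + k)) : M ((v^T *m (\sum_j g1 j *: map_mx C (A1 j)) *m v) ord0 ord0).
  rewrite -[v]vsubmxK augmented_form.
  have -> : \sum_j g1 j *: map_mx C (by_block A0 Ax Ay j) = AK.
    rewrite sum_by_block /g1 !by_blockE scale1r /AK; congr (_ + _ + _);
    by apply: eq_bigr => i _; rewrite !by_blockE.
  rewrite mxE; apply: (qmD qM); last exact: AM.
  rewrite /g1 by_blockE scale1r mxE big_ord1 mxE -expr2; exact: (qm_sqr qM).
have dual (c' : R) (w' : 'rV[R]_n) : sclos C M (C c' + \sum_i C (w' ord0 i) * gx i) \/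
    exists a x y, [/\ 0 <= a, psd (homog a x y) & a * c' + dot w' x < 0].
  have [h|[u [h1 h2]]] := linear_duality qM A1s A1M (row_mx c'%:M (row_mx w' 0)).
    left; move: h; rewrite sum_by_block /g1 !by_blockE row_mxEl mxE eqxx mulr1n mulr1.
    rewrite [X in _ + _ + X]big1 => [|i _]; last first.
      by rewrite row_mxEr row_mxEr mxE rmorph0 mul0r.
    rewrite addr0; congr (sclos C M (_ + _)).
    by apply: eq_bigr => i _; rewrite row_mxEr row_mxEl by_blockE.
  right; pose x := \row_i u ord0 (rshift 1 (lshift r i)).
  pose y := \row_i u ord0 (rshift 1 (rshift n i)).
  pose a := u ord0 (lshift (n + r) ord0).
  have hU : \sum_j u ord0 j *: by_block A0 Ax Ay j = homog a x y.
    rewrite sum_by_block !by_blockE /homog; congr (_ + _ + _);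
    by apply: eq_bigr => i _; rewrite by_blockE mxE.
  have form (b : 'M[R]_1) (v : 'cV[R]_k) :
     0 <= a * (b ord0 ord0) ^+ 2 + (v^T *m homog a x y *m v) ord0 ord0.
    have := h1 (col_mx b v)^T; rewrite trmxK.
    have := @augmented_form R idfun (fun j => u ord0 j) b v.
    under eq_bigr do rewrite map_mx_id//.
    under [in X in _ = _ + X -> _]eq_bigr do rewrite map_mx_id//.
    by move=> ->; rewrite hU mxE [X in X + _]mxE mxE big_ord1 mxE -expr2.
  exists a, x, y; split.
  - by have := form 1 0; rewrite mulmx0 !mxE eqxx expr1n mulr1 addr0.
  - apply/psdP; split=> [|v].
      rewrite /homog !linearD /= !raddf_sum /= linearZ /= hA0; congr (_ + _ + _);
      by apply: eq_bigr => i _; rewrite linearZ /= ?hAx ?hAy.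
    by have := form 0 v; rewrite mxE expr0n mulr0 add0r.
  - move: h2; rewrite dotE sum_by_block row_mxEl mxE eqxx mulr1n.
    rewrite [X in _ + _ + X]big1 => [|i _]; last first.
      by rewrite row_mxEr row_mxEr mxE mulr0.
    rewrite addr0 -/a dotE; congr (_ + _ < 0).
    by apply: eq_bigr => i _; rewrite row_mxEr row_mxEl mxE mulrC.
(* a certificate of negativity with a > 0 is a point of the projection *)
have point (a : R) x y : 0 < a -> psd (homog a x y) -> projection (a^-1 *: x).
  move=> a0 h; exists (a^-1 *: y); rewrite pencil_homog -(mulVf (lt0r_neq0 a0)).
  by rewrite homogZ; apply: psdZ => //; rewrite invr_ge0 ltW.
move=> hpos; have [//|[a [x [y [a0 pa neg]]]]] := dual c w.
have [a1|] := ltP 0 a.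
  have := hpos _ (point _ _ _ a1 pa); rewrite dotZr => h.
  have : 0 <= a * (c + a^-1 * dot w x) by rewrite mulr_ge0.
  by rewrite mulrDr mulrA mulfV ?gt_eqF// mul1r; lra.
move=> a1; have {a1} az : a = 0 by apply/eqP; rewrite eq_le a1.
have [[x0 PAx0]|noPA] := pselect (exists x, projection x).
  have [y0 p0] := PAx0; have h0 := hpos _ PAx0.
  have dneg : dot w x < 0 by move: neg; rewrite az mul0r add0r.
  pose s := (c + dot w x0 + 1) / - dot w x.
  have s0 : 0 <= s by rewrite divr_ge0//; lra.
  have sE : s * dot w x = - (c + dot w x0 + 1).
    by rewrite /s; field; rewrite lt_eqF.
  have : projection (x0 + s *: x).
    exists (y0 + s *: y); rewrite pencil_homog.
    have -> : 1 = 1 + s * a :> R by rewrite az mulr0 addr0.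
    by rewrite homogD -pencil_homog; apply: psdD => //; exact: psdZ.
  by move=> /hpos; rewrite dotDr dotZr sE; lra.
apply: (qm_all C (sclos_qmodule C qM)).
have [|[b [x' [y' [b0 pb]]]]] := dual (-1) 0.
  by rewrite big1 ?addr0 ?rmorphN1// => i _; rewrite mxE rmorph0 mul0r.
rewrite -[X in dot X _](scale0r (0 : 'rV[R]_n)) dotZl mul0r => bneg.
by case: noPA; exists (b^-1 *: x'); apply: point pb; lra.
Qed.

End PencilDuality.

(** * The quadratic module of a polynomial pencil *)

Section MatrixQuadraticModule.
Variables (K : comNzRingType) (k : nat) (A : 'M[K]_k).

Lemma in_QMD t (G H : 'M[K]_t) : in_QM A G -> in_QM A H -> in_QM A (G + H).
Proof.
move=> [L1 [g1 [p1 [h1 ->]]]] [L2 [g2 [p2 [h2 ->]]]].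
exists (L1 + L2)%N, (fun i => match fintype.split i with inl i => g1 i | inr i => g2 i end),
  (fun i => match fintype.split i with inl i => p1 i | inr i => p2 i end); split.
  by move=> i; case: fintype.split.
rewrite big_split_ord /=; congr (_ + _); apply: eq_bigr => i _.
  by rewrite (unsplitK (inl i)).
by rewrite (unsplitK (inr i)).
Qed.

Lemma in_QM0 t : in_QM A (0 : 'M[K]_t).
Proof. by exists 0, (fun=> 1%:M), (fun=> 0); split=> [[]//|]; rewrite big_ord0. Qed.

Lemma in_QM_sum t (I : eqType) (s : seq I) (F : I -> 'M[K]_t) :
  (forall i, in_QM A (F i)) -> in_QM A (\sum_(i <- s) F i).
Proof. by move=> h; apply: big_ind => //; [exact: in_QM0|exact: in_QMD]. Qed.

Lemma in_QM_congr t t' (G : 'M[K]_t) (q : 'M[K]_(t, t')) :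
  in_QM A G -> in_QM A (q^T *m G *m q).
Proof.
move=> [L [g [p [h ->]]]]; exists L, g, (fun i => p i *m q); split=> //.
rewrite mulmx_sumr mulmx_suml; apply: eq_bigr => i _.
by rewrite trmx_mul !mulmxA.
Qed.

Lemma in_QM_gram t (q : 'M[K]_(k, t)) : in_QM A (q^T *m q).
Proof.
exists 1, (fun=> 1%:M), (fun=> q); split=> [_|]; first by left.
by rewrite big_ord1 mulmx1.
Qed.

Lemma in_QM_gen t (q : 'M[K]_(k, t)) : in_QM A (q^T *m A *m q).
Proof.
exists 1, (fun=> A), (fun=> q); split=> [_|]; first by right.
by rewrite big_ord1.
Qed.

Definition scalar_QM (p : K) : Prop := in_QM A (p%:M : 'M[K]_1).

Lemma scalar_QM_qmodule : (0 < k)%N -> qmodule scalar_QM.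
Proof.
move=> k0; split.
- have := in_QM_gram (delta_mx (Ordinal k0) ord0 : 'cV[K]_k).
  rewrite trmx_delta mul_delta_mx /scalar_QM; congr in_QM.
  by apply/matrixP => i j; rewrite !ord1 !mxE.
- by move=> p q hp hq; rewrite /scalar_QM raddfD; exact: in_QMD.
- move=> q p hp; have := in_QM_congr (q%:M) hp.
  by rewrite tr_scalar_mx -!scalar_mxM mulrAC -expr2.
Qed.

Lemma scalar_QM_gen (w : 'cV[K]_k) : scalar_QM ((w^T *m A *m w) ord0 ord0).
Proof. by rewrite /scalar_QM -mx11_scalar; exact: in_QM_gen. Qed.

Lemma in_QM_scale t (R : realType) (C : {rmorphism R -> K}) p (S : 'M[R]_t) :
  scalar_QM p -> psd S -> in_QM A (p *: map_mx C S).
Proof.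
move=> hp /psd_decomp[s ->]; rewrite raddf_sum scaler_sumr /=.
apply: in_QM_sum => v; rewrite map_mxM -map_trmx.
have := in_QM_congr (map_mx C v)^T hp.
by rewrite trmxK mul_mx_scalar -scalemxAl.
Qed.

End MatrixQuadraticModule.

Section Polynomials.
Variables (R : realType) (n r k t : nat) (k0 : (0 < k)%N).
Variables (A0 : 'M[R]_k) (Ax : 'I_n -> 'M[R]_k) (Ay : 'I_r -> 'M[R]_k).
Hypotheses (hA0 : A0^T = A0) (hAx : forall i, (Ax i)^T = Ax i)
  (hAy : forall j, (Ay j)^T = Ay j).

Let A := poly_pencil A0 Ax Ay (xvars R n r) (yvars R n r).
Let C1 : {rmorphism R -> mpoly n R} := @mpolyC n R.
Let C2 : {rmorphism R -> mpoly (n + r) R} := @mpolyC (n + r) R.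
Let iota : {rmorphism mpoly n R -> mpoly (n + r) R} :=
  comp_mpoly [tuple mvar R (lshift r i) | i < n].
Let PA := projection A0 Ax Ay.

Let iotaC c : iota (C1 c) = C2 c.
Proof. exact: comp_mpolyC. Qed.

Let iotaX i : iota (mvar R i) = mvar R (lshift r i).
Proof. by rewrite /iota /= /mvar comp_mpolyXU -tnth_nth tnth_mktuple. Qed.

Let qM2 : qmodule (scalar_QM A).
Proof. exact: scalar_QM_qmodule. Qed.

(** The elements of the quadratic module that do not involve [y]. *)
Definition scalar_QM_x (p : mpoly n R) : Prop := scalar_QM A (iota p).

Lemma scalar_QM_x_qmodule : qmodule scalar_QM_x.
Proof.
case: qM2 => h1 h2 h3; split; rewrite /scalar_QM_x.
- by rewrite rmorph1.
- by move=> p q; rewrite rmorphD; exact: h2.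
- by move=> q p; rewrite rmorphM rmorphXn; exact: h3.
Qed.

Let qMx := scalar_QM_x_qmodule.

Lemma scalar_QM_x_affine (c : R) (w : 'rV[R]_n) :
  (forall x, PA x -> 0 <= c + dot w x) ->
  aclos C1 scalar_QM_x (C1 c + \sum_i C1 (w ord0 i) * mvar R i).
Proof.
move=> h e e0; rewrite /scalar_QM_x !rmorphD /= rmorph_sum !iotaC.
under eq_bigr do rewrite rmorphM /= iotaC iotaX.
apply: (sclos_aclos (C := C2)) e e0.
apply: (pencil_duality (M := scalar_QM A) (C := C2) hA0 hAx hAy qM2
   (gy := fun j => mvar R (rshift n j))) => // w'.
have -> : map_mx C2 A0 + \sum_i mvar R (lshift r i) *: map_mx C2 (Ax i) +
    \sum_j mvar R (rshift n j) *: map_mx C2 (Ay j) = A.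
  by rewrite /A /poly_pencil /pencil; congr (_ + _ + _); apply: eq_bigr => i _; rewrite mxE.
exact: scalar_QM_gen.
Qed.

Lemma scalar_QM_x_arch (N : R) :
  (forall x, PA x -> forall i, `|x ord0 i| <= N) -> arch C1 scalar_QM_x.
Proof.
move=> bPA.
have bX i : mbounded C1 scalar_QM_x (mvar R i).
  have [h1 h2] := coordinate_bounds bPA scalar_QM_x_affine i.
  have n0 := normr_ge0 N; have nN := ler_norm N.
  have key p : aclos C1 scalar_QM_x (C1 N + p) -> scalar_QM_x (C1 (`|N| + 1) + p).
    move=> h; rewrite (_ : _ + p = (C1 N + p) + C1 (`|N| + 1 - N)); last by ring.
    by apply: h; lra.
  by exists (`|N| + 1); [lra|split; exact: key].
suff h p : mbounded C1 scalar_QM_x p by move=> p; have [a _ [ha _]] := h p; exists a.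
elim/mpolyind: p => [|c m p _ _ hp].
  by rewrite -[0](mul0r 1) -(rmorph0 C1); apply: (mboundedZ qMx); exact: (mbounded1 C1 qMx).
apply: (mboundedD qMx) => //; rewrite -mul_mpolyC; apply: (mboundedZ qMx).
rewrite mpolyXE_id; elim/big_ind: _ => [|a b|i _].
- exact: (mbounded1 C1 qMx).
- exact: (mboundedM qMx).
elim: (m i) => [|e he]; first by rewrite expr0; exact: (mbounded1 C1 qMx).
by rewrite exprS; apply: (mboundedM qMx) => //; exact: bX.
Qed.

End Polynomials.

(** * The theorem *)

Section Evaluation.
Variables (R : realType) (n r k t : nat).
Variables (A0 : 'M[R]_k) (Ax : 'I_n -> 'M[R]_k) (Ay : 'I_r -> 'M[R]_k).

Let A := poly_pencil A0 Ax Ay (xvars R n r) (yvars R n r).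

(** Evaluation at a point of the spectrahedron turns a member of the quadratic
    module into a sum of congruences of psd matrices. *)
Lemma in_QM_eval (x : 'rV[R]_n) (y : 'rV[R]_r) (g : 'M[mpoly n R]_t) :
  psd (pencil A0 Ax Ay x y) -> in_QM A (x_to_xy r g) ->
  psd (map_mx (meval (x ord0)) g).
Proof.
move=> pA [L [G [p [hG e]]]].
pose ev : {rmorphism mpoly (n + r) R -> R} := meval (row_mx x y ord0).
have evX i : ev (mvar R (lshift r i)) = x ord0 i.
  by rewrite /ev /= /mvar mevalXU row_mxEl.
have evY i : ev (mvar R (rshift n i)) = y ord0 i.
  by rewrite /ev /= /mvar mevalXU row_mxEr.
have evC (S : 'M[R]_k) : map_mx ev (map_mx (@mpolyC (n + r) R) S) = S.
  by apply/matrixP => i j; rewrite !mxE; exact: mevalC.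
have evA : map_mx ev A = pencil A0 Ax Ay x y.
  rewrite /A /poly_pencil /pencil !map_mxD !raddf_sum /= evC.
  by congr (_ + _ + _); apply: eq_bigr => i _; rewrite map_mxZ /= mxE ?evX ?evY evC.
have -> : map_mx (meval (x ord0)) g = map_mx ev (x_to_xy r g).
  apply/matrixP => i j; rewrite !mxE /ev /= comp_mpoly_meval.
  apply: meval_eq => l; rewrite tnth_mktuple; exact/esym/evX.
rewrite e raddf_sum /=; apply: big_ind => [|G1 G2|i _].
- exact: psd0.
- exact: psdD.
rewrite !map_mxM /= -map_trmx; set q := map_mx ev (p i).
have /psdP[s1 s2] : psd (map_mx ev (G i)).
  by case: (hG i) => ->; rewrite ?evA // map_mx1; exact: (psd_scalar _ ler01).
apply/psdP; split=> [|v]; first by rewrite !trmx_mul trmxK s1 mulmxA.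
by have := s2 (q *m v); rewrite trmx_mul !mulmxA.
Qed.

End Evaluation.

Lemma coord_le_norm (R : realType) (n : nat) (x : 'rV[R]_n) (i : 'I_n) :
  `|x ord0 i| <= `|x|.
Proof.
rewrite [leRHS]/Num.norm /= mx_normrE; apply/bigmax_geP; right.
by exists (ord0, i).
Qed.

Theorem theorem4p1 (R : realType) (n r s k t : nat) (hk : (0 < k)%N)
    (A0 : 'M[R]_k) (Ax : 'I_n -> 'M[R]_k) (Ay : 'I_r -> 'M[R]_k)
    (B0 : 'M[R]_t) (Bx : 'I_n -> 'M[R]_t) (Bz : 'I_s -> 'M[R]_t)
    (hA0 : A0 \is symmetricmx) (hAx : forall i, Ax i \is symmetricmx)
    (hAy : forall j, Ay j \is symmetricmx)
    (hB0 : B0 \is symmetricmx) (hBx : forall i, Bx i \is symmetricmx)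
    (hBz : forall j, Bz j \is symmetricmx)
    (harch : archimedean_QM_x t
               (poly_pencil A0 Ax Ay (xvars R n r) (yvars R n r)))
    (hB : exists2 eps : R, 0 < eps &
            forall x : 'rV[R]_n,
              (exists y : 'rV[R]_r, psd (pencil A0 Ax Ay x y)) ->
              exists z : 'rV[R]_s, loewner_ge (pencil B0 Bx Bz x z) eps%:M) :
  exists f : 'rV[mpoly n R]_s,
    in_QM (poly_pencil A0 Ax Ay (xvars R n r) (yvars R n r))
      (x_to_xy r (poly_pencil B0 Bx Bz (\row_(i < n) mvar R i) f)).
Proof.
have sym m (S : 'M[R]_m) : S \is symmetricmx -> S^T = S by rewrite symE => /eqP.
have [g [[_ gQM] cg]] := harch.
have [N hN] : exists N : R, forall x, projection A0 Ax Ay x -> forall i, `|x ord0 i| <= N.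
  have [N [_ hN]] := compact_bounded cg; exists (N + 1) => x [y xy] i.
  apply: le_trans (coord_le_norm x i) _; apply: hN; first by rewrite ltrDl.
  exact: in_QM_eval xy gQM.
have qM := scalar_QM_qmodule (poly_pencil A0 Ax Ay (xvars R n r) (yvars R n r)) hk.
have hA0' := sym _ _ hA0; have hAx' i := sym _ _ (hAx i); have hAy' i := sym _ _ (hAy i).
have aM := scalar_QM_x_arch hk hA0' hAx' hAy' hN.
set A := poly_pencil _ _ _ _ _ in qM aM *.
pose C : {rmorphism R -> mpoly n R} := @mpolyC n R.
pose C2 : {rmorphism R -> mpoly (n + r) R} := @mpolyC (n + r) R.
pose T (G : 'M[mpoly n R]_t) := in_QM A (x_to_xy r G).
have TD G H : T G -> T H -> T (G + H).
  by move=> hG hH; rewrite /T /x_to_xy map_mxD; exact: in_QMD.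
have TM p (S : 'M[R]_t) : scalar_QM_x A0 Ax Ay p -> psd S -> T (p *: map_mx C S).
  move=> hp pS; rewrite /T /x_to_xy map_mxZ /=.
  have -> : map_mx (comp_mpoly [tuple mvar R (lshift r i) | i < n]) (map_mx C S) = map_mx C2 S.
    by apply/matrixP => i j; rewrite !mxE; exact: comp_mpolyC.
  exact: in_QM_scale.
have [z hz] := @certified_selection R _ C _ (scalar_QM_x_qmodule hk A0 Ax Ay) aM t T TD TM n s
  (fun i => mvar R i) (projection A0 Ax Ay) N hN
  (fun x y a => @projection_convex R n r k A0 Ax Ay x y a)
  (fun c w => @scalar_QM_x_affine R n r k hk A0 Ax Ay hA0' hAx' hAy' c w)
  B0 Bx Bz (sym _ _ hB0) (fun i => sym _ _ (hBx i)) hB.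
exists (\row_j z j).
suff -> : poly_pencil B0 Bx Bz (\row_i mvar R i) (\row_j z j) =
  pencil_at C (fun i => mvar R i) B0 Bx Bz z by exact: hz.
rewrite /poly_pencil /pencil /pencil_at.
rewrite (eq_bigr (fun i => mvar R i *: map_mx C (Bx i))); last by move=> i _; rewrite mxE.
by rewrite [X in _ + X](eq_bigr (fun j => z j *: map_mx C (Bz j))) // => i _; rewrite mxE.
Qed.
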